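(* Let $G$ be a group and $M$ a $G$-module. (i) The homomorphism $\beta^i:H^i_\lambda(G,M)\to H^i(G,M)$ is an isomorphism for $i=0$ and $i=1$, while $\beta^2$ and $\beta^3$ fit in an exact sequence $$0\to H^2_\lambda(G,M)\xrightarrow{\beta^2}H^2(G,M)\to\prod_{C_2\subset G}H^2(C_2,M)\to H^3_\lambda(G,M)\xrightarrow{\beta^3}H^3(G,M).$$ (ii) If $G$ has no elements of order two, then $\beta^2$ is an isomorphism, while $\beta^3,\beta^4,\beta^5$ fit in an exact sequence $$0\to H^3_\lambda(G,M)\xrightarrow{\beta^3}H^3(G,M)\to\prod_{C_3\subset G}H^3(C_3,M)\to H^4_\lambda(G,M)\xrightarrow{\beta^4}H^4(G,M)\to\prod_{C_3\subset G}H^4(C_3,M)\to H^5_\lambda(G,M)\xrightarrow{\beta^5}H^5(G,M).$$ (iii) If all nontrivial elements of $G$ are of infinite order, then $\beta^i:H^i_\lambda(G,M)\to H^i(G,M)$ is an isomorphism for all $i\geq 0$. Here $\prod_{C_\ell\subset G}$ denotes the product over all subgroups $C_\ell$ of $G$ of order $\ell$, with $C_\ell$ acting on $M$ by restriction of the action of $G$.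
   Context: Let $G$ be a group and $M$ a (left) $G$-module. $H^*(G,M)$ is the usual (Eilenberg-MacLane) group cohomology, computed as the cohomology of the cochain complex $K^*(G,M)$, where $K^n(G,M)=\mathrm{Hom}_{\mathbb{Z}[G]}(\mathbb{Z}[G^{n+1}],M)$ is the group of functions $f:G^{n+1}\to M$ with $f(sg_0,\dots,sg_n)=s\cdot f(g_0,\dots,g_n)$, and the differential is $(\partial f)(g_0,\dots,g_{n+1})=\sum_{j=0}^{n+1}(-1)^j f(g_0,\dots,\widehat{g_j},\dots,g_{n+1})$. Exterior cohomology: $K^*_\lambda(G,M)$ is the subcomplex of $K^*(G,M)$ where $K^n_\lambda(G,M)$ consists of all $f\in K^n(G,M)$ such that, for all $0\le i<n$, $f(g_0,\dots,g_n)=0$ whenever $g_i=g_{i+1}$, and $f(g_0,\dots,g_i,g_{i+1},\dots,g_n)=-f(g_0,\dots,g_{i+1},g_i,\dots,g_n)$. Equivalently $K^n_\lambda(G,M)=\mathrm{Hom}_{\mathbb{Z}[G]}(\Lambda^{n+1}(\mathbb{Z}[G]),M)$, where $\Lambda^*$ is the exterior algebra over $\mathbb{Z}$ and $G$ acts diagonally. Its cohomology is denoted $H^n_\lambda(G,M)$ (the exterior cohomology of $G$). The map $\beta^n:H^n_\lambda(G,M)\to H^n(G,M)$ is induced by the inclusion $K^*_\lambda(G,M)\hookrightarrow K^*(G,M)$. *)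

(* Defs.v *)
From HB Require Import structures.
From mathcomp Require Import all_boot all_algebra perm.
From mathcomp Require Import zify.
From mathcomp Require Import boolp classical_sets functions cardinality.

Set Implicit Arguments.
Unset Strict Implicit.
Unset Printing Implicit Defensive.

Import GRing.Theory.
Import Quotient.Exports.

Local Open Scope ring_scope.

Record cochain_complex := CochainComplex {
  cc_obj :> nat -> zmodType;
  cc_diff : forall n, {additive cc_obj n -> cc_obj n.+1};
  cc_diffK : forall n (x : cc_obj n), cc_diff n.+1 (cc_diff n x) = 0
}.

Section Cohomology.
Variables (X : cochain_complex) (n : nat).

Definition cocycle_pred : {pred X n} := fun x => cc_diff X n x == 0.

Fact cocycle_zmod_closed : zmod_closed cocycle_pred.
Proof.
split=> [|x y]; rewrite !unfold_in ?raddf0 //.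
by move=> /eqP dx /eqP dy; rewrite raddfB /= dx dy subrr.
Qed.
HB.instance Definition _ :=
  GRing.isZmodClosed.Build (X n) cocycle_pred cocycle_zmod_closed.

Record cocycle := Cocycle {
  cocycle_val :> X n;
  cocycleP : cocycle_val \in cocycle_pred
}.
HB.instance Definition _ := [isSub for cocycle_val].
HB.instance Definition _ := [Choice of cocycle by <:].
HB.instance Definition _ := [SubChoice_isSubZmodule of cocycle by <:].

End Cohomology.

(* In degree 0 the incoming term of the complex is zero. *)
Definition is_coboundary (X : cochain_complex) (n : nat) : X n -> Prop :=
  match n return X n -> Prop with
  | 0 => fun x => x = 0
  | m.+1 => fun x => exists y : X m, cc_diff X m y = x
  end.

Fact is_coboundaryB (X : cochain_complex) (n : nat) (x y : X n) :
  is_coboundary x -> is_coboundary y -> is_coboundary (x - y).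
Proof.
case: n x y => [|m] x y /=; first by move=> -> ->; rewrite subrr.
by move=> [a <-] [b <-]; exists (a - b); rewrite raddfB.
Qed.

Section CohomologyQuotient.
Variables (X : cochain_complex) (n : nat).

Definition coboundary_pred : {pred cocycle X n} :=
  fun z => `[< is_coboundary (val z) >].

Fact coboundary_zmod_closed : zmod_closed coboundary_pred.
Proof.
split=> [|x y]; rewrite !unfold_in.
  apply/asboolP; rewrite raddf0; case: (n) => [//|m] /=.
  by exists 0; rewrite raddf0.
move=> /asboolP Bx /asboolP By; apply/asboolP; rewrite raddfB.
exact: is_coboundaryB.
Qed.
HB.instance Definition _ :=
  GRing.isZmodClosed.Build (cocycle X n) coboundary_pred coboundary_zmod_closed.

Definition cohomology : zmodType := Quotient.quot coboundary_pred.

End CohomologyQuotient.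

Record chain_map (X Y : cochain_complex) := ChainMap {
  cm_fun :> forall n, {additive X n -> Y n};
  cm_comm : forall n (x : X n),
    cc_diff Y n (cm_fun n x) = cm_fun n.+1 (cc_diff X n x)
}.

Section InducedMap.
Variables (X Y : cochain_complex) (f : chain_map X Y) (n : nat).

Fact cocycle_map_subproof (z : cocycle X n) :
  f n (val z) \in cocycle_pred (X := Y) (n := n).
Proof.
by rewrite unfold_in cm_comm (eqP (cocycleP z)) raddf0.
Qed.

Definition cocycle_map (z : cocycle X n) : cocycle Y n :=
  Cocycle (cocycle_map_subproof z).

Definition cohomology_map (h : cohomology X n) : cohomology Y n :=
  \pi_(cohomology Y n)%qT (cocycle_map (repr h)).

Fact is_coboundary_map (x : X n) : is_coboundary x -> is_coboundary (f n x).
Proof.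
case: n x => [|m] x /=; first by move->; rewrite raddf0.
by move=> [y <-]; exists (f m y); rewrite cm_comm.
Qed.

Fact cocycle_map_zmod_morphism : zmod_morphism cocycle_map.
Proof. by move=> x y; apply: val_inj; rewrite /= !raddfB. Qed.

Lemma cohomology_mapE (z : cocycle X n) :
  cohomology_map (\pi_(cohomology X n)%qT z)
  = \pi_(cohomology Y n)%qT (cocycle_map z).
Proof.
apply/eqP; rewrite -Quotient.idealrBE -cocycle_map_zmod_morphism.
have: repr (\pi_(cohomology X n)%qT z) - z \in @coboundary_pred X n.
  by rewrite Quotient.idealrBE reprK.
by rewrite !unfold_in => /asboolP Bz; apply/asboolP/is_coboundary_map.
Qed.

Fact cohomology_map_zmod_morphism : zmod_morphism cohomology_map.
Proof.
move=> x y; rewrite -[x]reprK -[y]reprK.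
rewrite -[X in cohomology_map X]raddfB !cohomology_mapE.
by rewrite cocycle_map_zmod_morphism raddfB.
Qed.
HB.instance Definition _ :=
  GRing.isZmodMorphism.Build (cohomology X n) (cohomology Y n) cohomology_map
    cohomology_map_zmod_morphism.

End InducedMap.
Arguments cohomology_map {X Y} f n.

HB.mixin Record Zmodule_isGmodule (G : groupType) M of GRing.Zmodule M := {
  gact : G -> M -> M;
  gact1 : forall x, gact 1%g x = x;
  gactM : forall s t x, gact (s * t)%g x = gact s (gact t x);
  gactD : forall s, {morph gact s : x y / x + y}
}.

#[short(type="gmodType")]
HB.structure Definition Gmodule (G : groupType) :=
  {M of GRing.Zmodule M & Zmodule_isGmodule G M}.

Lemma gact0 (G : groupType) (M : gmodType G) (s : G) : gact s (0 : M) = 0.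
Proof. by apply: (addrI (gact s 0)); rewrite -gactD !addr0. Qed.

Lemma gactN (G : groupType) (M : gmodType G) (s : G) (x : M) :
  gact s (- x) = - gact s x.
Proof. by apply: (addrI (gact s x)); rewrite -gactD !subrr gact0. Qed.

Lemma gactB (G : groupType) (M : gmodType G) (s : G) :
  {morph gact s : x y / x - y :> M}.
Proof. by move=> x y; rewrite gactD gactN. Qed.

Section GroupCochains.
Variables (G : groupType) (M : gmodType G).

Definition equivariant n : {pred ('I_n.+1 -> G) -> M} :=
  fun f => `[< forall s g, f (fun i => s * g i)%g = gact s (f g) >].

Fact equivariant_zmod_closed n : zmod_closed (@equivariant n).
Proof.
split=> [|f g]; rewrite !unfold_in; first by apply/asboolP => s h; rewrite gact0.
move=> /asboolP Ef /asboolP Eg; apply/asboolP => s h.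
by rewrite [LHS]/GRing.add /= [X in gact s X]/GRing.add /= gactB -Ef -Eg.
Qed.
HB.instance Definition _ n :=
  GRing.isZmodClosed.Build (('I_n.+1 -> G) -> M) (@equivariant n)
    (@equivariant_zmod_closed n).

Record cochain n := Cochain {
  cochain_fun :> ('I_n.+1 -> G) -> M;
  cochainP : cochain_fun \in @equivariant n
}.
HB.instance Definition _ n := [isSub for @cochain_fun n].
HB.instance Definition _ n := [Choice of cochain n by <:].
HB.instance Definition _ n := [SubChoice_isSubZmodule of cochain n by <:].

(* [g \o lift j] is (g_0, ..., g_(n+1)) with g_j omitted. *)
Definition coface_sum n (f : ('I_n.+1 -> G) -> M) : ('I_n.+2 -> G) -> M :=
  fun g => \sum_(j < n.+2) f (g \o lift j) *~ (-1) ^+ j.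

Lemma cochain_equivariant n (f : cochain n) s g :
  f (fun i => s * g i)%g = gact s (f g).
Proof. by have /asboolP := cochainP f. Qed.

Fact coface_sum_equivariant n (f : cochain n) :
  coface_sum f \in @equivariant n.+1.
Proof.
apply/asboolP => s g; rewrite /coface_sum.
rewrite (big_morph (gact s) (gactD s) (gact0 M s)).
apply: eq_bigr => j _.
rewrite (_ : _ \o _ = fun i => s * (g \o lift j) i)%g // cochain_equivariant.
by rewrite -signr_odd; case: (odd j); rewrite ?expr1 ?expr0 ?mulrNz ?gactN.
Qed.

Definition cochain_diff n (f : cochain n) : cochain n.+1 :=
  Cochain (coface_sum_equivariant f).

Lemma coface_sumB n : zmod_morphism (@coface_sum n).
Proof.
move=> f h; apply/funext => g.
rewrite [RHS]/GRing.add /= [X in _ = _ + X]/GRing.opp /= /coface_sum -sumrB.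
by apply: eq_bigr => j _; rewrite -mulrzBl.
Qed.

Fact cochain_diff_zmod_morphism n : zmod_morphism (@cochain_diff n).
Proof.
move=> f h; apply: val_inj; rewrite [RHS]raddfB /=.
by rewrite -coface_sumB; congr coface_sum; exact: (raddfB val).
Qed.
HB.instance Definition _ n :=
  GRing.isZmodMorphism.Build (cochain n) (cochain n.+1) (@cochain_diff n)
    (@cochain_diff_zmod_morphism n).

Lemma coface_sumK n (f : ('I_n.+1 -> G) -> M) : coface_sum (coface_sum f) = 0.
Proof.
apply/funext => g; rewrite /coface_sum.
under eq_bigr do rewrite mulrz_suml.
rewrite pair_bigA /=.
pose F (p : 'I_n.+3 * 'I_n.+2) :=
  f ((g \o lift p.1) \o lift p.2) *~ (-1) ^+ p.2 *~ (-1) ^+ p.1.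
pose P (p : 'I_n.+3 * 'I_n.+2) := (p.2 < p.1)%N.
pose h (p : 'I_n.+3 * 'I_n.+2) : 'I_n.+3 * 'I_n.+2 :=
  if P p then (inord p.2, inord p.1.-1) else (inord p.2.+1, inord p.1).
have hE (p : 'I_n.+3 * 'I_n.+2) : ((h p).1 = (if P p then p.2 : nat else p.2.+1) :> nat)
    /\ ((h p).2 = (if P p then p.1.-1 else p.1 : nat) :> nat).
  case: p => j k; have := ltn_ord j; have := ltn_ord k.
  by rewrite /h /P /=; case: (ltnP k j) => jk kn jn /=; rewrite !inordK; lia.
have hK : involutive h.
  move=> p; have [h1 h2] := hE p; have [k1 k2] := hE (h p).
  case: p => j k in h1 h2 k1 k2 *.
  rewrite [LHS]surjective_pairing; congr pair; apply: val_inj.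
    rewrite [LHS]k1 /P h1 h2 /P /=.
    by case: (ltnP k j) => jk; case: ltnP; lia.
  rewrite [LHS]k2 /P h1 h2 /P /=.
  by case: (ltnP k j) => jk; case: ltnP; lia.
have hP p : ~~ P (h p) = P p.
  have [h1 h2] := hE p; rewrite [in LHS]/P h1 h2 /P.
  by case: p {h1 h2} => j k /=; case: (ltnP k j); lia.
have hF p : P p -> F (h p) = - F p.
  move=> Pp; have [h1 h2] := hE p; rewrite Pp in h1 h2.
  rewrite /F -!mulrzA -!exprD h1 h2.
  have -> : (g \o lift (h p).1) \o lift (h p).2 = (g \o lift p.1) \o lift p.2.
    apply/funext => i /=; congr g; apply: val_inj; rewrite /= h1 h2.
    by move: Pp; rewrite /P /bump; lia.
  have -> : (p.2 + p.1 = (p.1.-1 + p.2).+1)%N by move: Pp; rewrite /P; lia.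
  by rewrite exprS mulN1r mulrNz opprK.
rewrite (bigID P) /= -[X in X + _]/(\sum_(p | P p) F p).
rewrite -[X in _ + X]/(\sum_(p | ~~ P p) F p).
rewrite [X in _ + X](reindex_inj (inv_inj hK)) /=.
under [X in _ + X]eq_bigl do rewrite hP.
by rewrite (eq_bigr _ hF) sumrN subrr.
Qed.

Fact cochain_diffK n (f : cochain n) : cochain_diff (cochain_diff f) = 0.
Proof. by apply: val_inj; rewrite [RHS]raddf0 /= coface_sumK. Qed.

Definition group_complex : cochain_complex :=
  @CochainComplex (fun n => cochain n : zmodType)
    (fun n => @cochain_diff n : {additive _ -> _}) cochain_diffK.

(* For i < n, the positions i and i+1 among 0, ..., n. *)
Definition pos n (i : 'I_n) : 'I_n.+1 := widen_ord (leqnSn n) i.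
Definition succ_pos n (i : 'I_n) : 'I_n.+1 := lift ord0 i.

Definition alternating n : {pred cochain n} := fun f =>
  `[< forall i : 'I_n,
        (forall g, g (pos i) = g (succ_pos i) -> f g = 0) /\
        (forall g, f g = - f (g \o tperm (pos i) (succ_pos i))) >].

Fact alternating_zmod_closed n : zmod_closed (@alternating n).
Proof.
split=> [|f h]; rewrite !unfold_in.
  have Z g : (0 : cochain n) g = 0 by rewrite -[LHS]/(val 0 g) raddf0.
  by apply/asboolP => i; split=> g; rewrite !Z ?oppr0.
move=> /asboolP Af /asboolP Ah; apply/asboolP => i.
have E g : (f - h) g = f g - h g by rewrite -[LHS]/(val (f - h) g) raddfB.
have [f0 fN] := Af i; have [h0 hN] := Ah i; split=> g.
  by move=> gi; rewrite E f0 // h0 // subrr.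
by rewrite !E fN hN opprD.
Qed.
HB.instance Definition _ n :=
  GRing.isZmodClosed.Build (cochain n) (@alternating n)
    (@alternating_zmod_closed n).

Record ext_cochain n := ExtCochain {
  ext_cochain_val :> cochain n;
  ext_cochainP : ext_cochain_val \in @alternating n
}.
HB.instance Definition _ n := [isSub for @ext_cochain_val n].
HB.instance Definition _ n := [Choice of ext_cochain n by <:].
HB.instance Definition _ n := [SubChoice_isSubZmodule of ext_cochain n by <:].

Lemma lift_pos n (i : 'I_n.+1) :
  tperm (pos i) (succ_pos i) \o lift (pos i) = lift (succ_pos i).
Proof.
apply/funext => k; apply: val_inj => /=.
case: tpermP => [/(congr1 val)|/(congr1 val)|] /=; rewrite /bump /=; try lia.
move=> /eqP/negbTE a /eqP/negbTE b; move: a b.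
by rewrite -!val_eqE /= /bump; lia.
Qed.

Lemma lift_succ_pos n (i : 'I_n.+1) :
  tperm (pos i) (succ_pos i) \o lift (succ_pos i) = lift (pos i).
Proof. by apply/funext => k; rewrite -lift_pos /= tpermK. Qed.

Lemma lift_other n (i : 'I_n.+1) (j : 'I_n.+2) :
  j != pos i -> j != succ_pos i -> exists i' : 'I_n,
  [/\ lift j (pos i') = pos i, lift j (succ_pos i') = succ_pos i &
      tperm (pos i) (succ_pos i) \o lift j
      = lift j \o tperm (pos i') (succ_pos i')].
Proof.
move=> ja jb; have nz : (unbump j i < n)%N.
  move: ja jb; rewrite -!val_eqE /= /bump /unbump /=.
  by have := ltn_ord i; have := ltn_ord j; lia.
exists (Ordinal nz).
have E1 : lift j (pos (Ordinal nz)) = pos i.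
  apply: val_inj; move: ja jb; rewrite -!val_eqE /= /bump /unbump /=.
  by have := ltn_ord i; have := ltn_ord j; lia.
have E2 : lift j (succ_pos (Ordinal nz)) = succ_pos i.
  apply: val_inj; move: ja jb; rewrite -!val_eqE /= /bump /unbump /=.
  by have := ltn_ord i; have := ltn_ord j; lia.
split=> //; apply/funext => k /=; rewrite -E1 -E2.
by rewrite (inj_tperm _ _ _ lift_inj).
Qed.

Fact cochain_diff_alternating n (f : ext_cochain n) :
  cochain_diff f \in @alternating n.+1.
Proof.
have /asboolP Af := ext_cochainP f; apply/asboolP => i.
have ab : succ_pos i != pos i by rewrite -val_eqE /= /bump; lia.
split=> g; rewrite /= /coface_sum.
  move=> gi; rewrite (bigD1 (pos i)) //= (bigD1 (succ_pos i)) //=.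
  rewrite big1 ?addr0 => [|j /andP[ja jb]]; last first.
    have [i' [E1 E2 _]] := lift_other ja jb.
    by rewrite (Af i').1 ?mul0rz //= E1 E2.
  have -> : g \o lift (pos i) = g \o lift (succ_pos i).
    rewrite -lift_pos; apply/funext => k /=; case: tpermP => [e|e|//].
      by have := neq_lift (pos i) k; rewrite e eqxx.
    by rewrite e.
  by rewrite /= /bump /= add1n exprS mulN1r mulrNz subrr.
rewrite (bigD1 (pos i)) //= (bigD1 (succ_pos i)) //=.
rewrite [in RHS](bigD1 (pos i)) //= [in RHS](bigD1 (succ_pos i)) //=.
have -> : (g \o tperm (pos i) (succ_pos i)) \o lift (pos i)
          = g \o lift (succ_pos i) by rewrite -lift_pos.
have -> : (g \o tperm (pos i) (succ_pos i)) \o lift (succ_pos i)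
          = g \o lift (pos i) by rewrite -lift_succ_pos.
rewrite /= /bump /= add1n exprS mulN1r !mulrNz !opprD opprK addrCA !addrA.
congr (_ + _); rewrite -sumrN; apply: eq_bigr => j /andP[ja jb].
have [i' [_ _ E]] := lift_other ja jb.
by rewrite (Af i').2 -compA -E mulNrz.
Qed.
Definition ext_cochain_diff n (f : ext_cochain n) : ext_cochain n.+1 :=
  ExtCochain (cochain_diff_alternating f).

Fact ext_cochain_diff_zmod_morphism n : zmod_morphism (@ext_cochain_diff n).
Proof.
move=> f h; apply: val_inj; rewrite [RHS]raddfB /=.
by rewrite -raddfB; congr cochain_diff; exact: (raddfB val).
Qed.
HB.instance Definition _ n :=
  GRing.isZmodMorphism.Build (ext_cochain n) (ext_cochain n.+1)
    (@ext_cochain_diff n) (@ext_cochain_diff_zmod_morphism n).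

Fact ext_cochain_diffK n (f : ext_cochain n) :
  ext_cochain_diff (ext_cochain_diff f) = 0.
Proof. by apply: val_inj; rewrite [RHS]raddf0 /= cochain_diffK. Qed.

Definition ext_complex : cochain_complex :=
  @CochainComplex (fun n => ext_cochain n : zmodType)
    (fun n => @ext_cochain_diff n : {additive _ -> _}) ext_cochain_diffK.

Definition ext_inclusion : chain_map ext_complex group_complex :=
  @ChainMap ext_complex group_complex
    (fun n => (val : ext_cochain n -> cochain n) : {additive _ -> _})
    (fun n f => erefl).

End GroupCochains.

Definition Hgrp (n : nat) (G : groupType) (M : gmodType G) : zmodType :=
  cohomology (group_complex M) n.
Arguments Hgrp n G M : clear implicits.

Definition Hlam (n : nat) (G : groupType) (M : gmodType G) : zmodType :=
  cohomology (ext_complex M) n.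
Arguments Hlam n G M : clear implicits.

Definition beta (n : nat) (G : groupType) (M : gmodType G) :
    {additive Hlam n G M -> Hgrp n G M} :=
  cohomology_map (ext_inclusion M) n : {additive _ -> _}.
Arguments beta n G M : clear implicits.

Section Subgroups.
Variables (G : groupType) (C : groupClosed G).

Definition sg_type := {x : G | x \in C}.

Fact sg_group_closed : group_closed C.
Proof. by split=> [|x y xC yC]; [exact: gpred1 | exact: gpredF]. Qed.
HB.instance Definition _ := SubType.on sg_type.
HB.instance Definition _ := Choice.on sg_type.
HB.instance Definition _ :=
  SubChoice_isSubGroup.Build G (fun x => x \in C) sg_type sg_group_closed.

End Subgroups.

(* A copy of M, so that it can carry the structure of a C-module below. *)
Definition resmod (G : groupType) (C : groupClosed G) (M : gmodType G) : Type :=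
  M.
Arguments resmod {G} C M.

Section Restriction.
Variables (G : groupType) (C : groupClosed G) (M : gmodType G).
HB.instance Definition _ := GRing.Zmodule.on (resmod C M).
HB.instance Definition _ :=
  @Zmodule_isGmodule.Build (sg_type C) (resmod C M) (fun s (x : M) => gact (val s) x)
    (@gact1 G M) (fun s t => @gactM G M (val s) (val t))
    (fun s => @gactD G M (val s)).
End Restriction.

(* So [groupClosed G] has one element per subgroup, and [Hprod] below repeats
   no factor. *)
Lemma groupClosed_inj (G : groupType) (C D : groupClosed G) : C =i D -> C = D.
Proof.
case: C D => [C [[c1] [c2] [c3]]] [D [[d1] [d2] [d3]]] /= e.
have E : C = D by apply/funext => x; exact: e.
by subst D; rewrite (Prop_irrelevance c1 d1) (Prop_irrelevance c2 d2)
  (Prop_irrelevance c3 d3).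
Qed.

Definition subgroup_of_order (l : nat) (G : groupType) : Type :=
  {C : groupClosed G | ([set` C] #= `I_l)%card}.

Section DirectProduct.
Variables (I : Type) (T : I -> zmodType).

Definition dprod : Type := forall i, T i.

HB.instance Definition _ := Choice.copy dprod (forall i, T i).

Let add (x y : dprod) : dprod := fun i => x i + y i.
Let opp (x : dprod) : dprod := fun i => - x i.
Let zero : dprod := fun i => 0.

Let addA : associative add.
Proof. by move=> x y z; apply: functional_extensionality_dep => i; exact: addrA. Qed.
Let addC : commutative add.
Proof. by move=> x y; apply: functional_extensionality_dep => i; exact: addrC. Qed.
Let add0 : left_id zero add.
Proof. by move=> x; apply: functional_extensionality_dep => i; exact: add0r. Qed.
Let addN : left_inverse zero opp add.
Proof. by move=> x; apply: functional_extensionality_dep => i; exact: addNr. Qed.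

HB.instance Definition _ := GRing.isZmodule.Build dprod addA addC add0 addN.
End DirectProduct.

Definition Hprod (l n : nat) (G : groupType) (M : gmodType G) : zmodType :=
  dprod (fun C : subgroup_of_order l G => Hgrp n (sg_type (sval C)) (resmod (sval C) M)).
Arguments Hprod l n G M : clear implicits.

Definition exact_at (A B C : zmodType) (f : A -> B) (g : B -> C) : Prop :=
  forall y, g y = 0 <-> exists x, f x = y.

Definition has_order (G : groupType) (g : G) (l : nat) : Prop :=
  [/\ (0 < l)%N, (g ^+ l = 1)%g & forall k, (0 < k < l)%N -> (g ^+ k <> 1)%g].

Definition infinite_order (G : groupType) (g : G) : Prop :=
  forall k, (0 < k)%N -> (g ^+ k <> 1)%g.

(* Main.v *)
From HB Require Import structures.
From mathcomp Require Import all_boot all_algebra fingroup perm action cyclic.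
From mathcomp Require Import zify.
From mathcomp Require Import boolp classical_sets functions cardinality.
Require Import Defs.

Set Implicit Arguments.
Unset Strict Implicit.
Unset Printing Implicit Defensive.

Import GRing.Theory.
Import Quotient.Exports.

Local Open Scope ring_scope.

(** Let [Alt n] ([altfun M n]) be the [G]-module of alternating functions of [n]
    variables in [G] with values in [M], that is, of homomorphisms from the
    [n]-th exterior power of Z[G] to [M]. The complex
    [M = Alt 0 -> Alt 1 -> Alt 2 -> ...] is exact, and its invariants form the
    exterior complex (with [Alt n.+1] in degree [n]). Let [Z n] ([Altz M n]) be
    the kernel of [Alt n -> Alt n.+1]. Then [Z 1] is [M], and
    [0 -> Z n -> Alt n -> Z n.+1 -> 0] is exact, so everything follows from long
    exact sequences once H^k(G, Alt n) is known for positive [k].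

    - Exterior cohomology ([ext_cohomology]): in degree [n > 0] it is the
      invariants of [Z n.+1] modulo those of [Alt n], which the connecting map
      identifies with the kernel of [H^1(Z n) -> H^1(Alt n)].
    - Comparison ([curry_class_conn], [dimension_shift]): as long as the modules
      [Alt i] passed on the way are acyclic, the connecting maps
      [H^1(Z n) -> H^2(Z n.-1) -> ... -> H^n(Z 1)] are isomorphisms. They carry
      an exterior class to its image in H^n(G, M): reading the first [k.+1]
      variables of an alternating cocycle as group variables gives explicit
      cocycles and explicit lifts for all these maps.
    - Acyclicity ([altcoh_cone]): a symmetric equivariant choice of a group
      element for each [n]-subset of [G] contracts the cochains with values in
      [Alt n]. It exists if [G] acts freely on [n]-subsets ([alt_acyclic]),
      for instance if [n = 1], if [n = 2] or [4] and there are no involutions,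
      or for all [n] if there is no torsion. Averaging over all elements of the
      subset shows in any case that [n] kills H^k(G, Alt n)
      ([altcoh_torsion]).
    - Prime size ([alt_prime_subgroups]): for a prime [l], an orbit of
      [l]-subsets that is not free contains exactly one subgroup of order [l],
      whence H^k(G, Alt l) is the product of the H^k(C, Alt l) over these
      subgroups [C], and only functions on [C] count. For the group [C] itself
      the complex stops at [Alt l], and the earlier terms are acyclic, so for
      positive [k] H^k(C, Alt l) is H^(k + l - 1)(C, M)
      ([prime_order_shift]).

    Splicing gives the two exact sequences ([sequence_low], [sequence_high]).
    The map from the product lands in exterior cohomology because the
    obstruction is a homomorphism from a group killed by [n] to one killed by
    [n + 1] or by [n + 2] (for odd [n]), hence zero. *)

(** * Additive maps *)

Section AdditiveOf.
Variables (A B : zmodType) (f : A -> B) (fB : zmod_morphism f).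
Let g := f.
HB.instance Definition _ := GRing.isZmodMorphism.Build A B g fB.
Definition additive_of : {additive A -> B} := g.
End AdditiveOf.

(** Connecting maps and inverses on images depend on choices of lifts. This
    lemma makes the choices once: elsewhere only the relation between an element
    and its possible values has to be exhibited. *)
Lemma additive_of_rel (A B : zmodType) (R : A -> B -> Prop) :
  (forall a, exists b, R a b) ->
  (forall a a' b b', R a b -> R a' b' -> R (a - a') (b - b')) ->
  (forall b, R 0 b -> b = 0) ->
  exists f : {additive A -> B}, forall a b, R a b -> f a = b.
Proof.
move=> tot RB R0.
have uniq a b b' : R a b -> R a b' -> b = b'.
  by move=> h h'; apply/eqP; rewrite -subr_eq0; apply/eqP/R0; rewrite -(subrr a); apply: RB.
have [f fP] := choice tot.
have fB : zmod_morphism f by move=> x y; apply: uniq (fP _) (RB _ _ _ _ _ _).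
by exists (additive_of fB) => a b; apply: uniq (fP a).
Qed.

Lemma additive_inj (A B : zmodType) (f : {additive A -> B}) :
  (forall x, f x = 0 -> x = 0) -> injective f.
Proof.
move=> f0 x y fxy; apply/eqP; rewrite -subr_eq0; apply/eqP/f0.
by rewrite raddfB fxy subrr.
Qed.

Lemma inj_surj_bij (A B : Type) (f : A -> B) :
  injective f -> (forall b, exists a, f a = b) -> bijective f.
Proof.
move=> fI fS; have [g gP] := choice fS.
by exists g => // x; apply: fI.
Qed.

Lemma bij_surj (A B : Type) (f : A -> B) :
  bijective f -> forall b, exists a, f a = b.
Proof. by case=> g _ gK b; exists (g b). Qed.

Lemma additive_inv (A B : zmodType) (f : {additive A -> B}) : bijective f ->
  exists g : {additive B -> A}, cancel f g /\ cancel g f.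
Proof.
case=> g fK gK; have gB : zmod_morphism g.
  by move=> x y; apply: (can_inj fK); rewrite raddfB !gK.
by exists (additive_of gB).
Qed.

(** Mere existence is enough: the exact sequences do not prescribe their maps to
    and from the products. *)
Definition iso (A B : zmodType) : Prop :=
  exists f : {additive A -> B}, bijective f.

Lemma iso_sym (A B : zmodType) : iso A B -> iso B A.
Proof. by case=> f /additive_inv[g [fK gK]]; exists g; exists f. Qed.

Lemma iso_trans (A B C : zmodType) : iso A B -> iso B C -> iso A C.
Proof. by move=> [f fb] [g gb]; exists (g \o f); exact: bij_comp. Qed.

Lemma iso_dprod (I : Type) (T U : I -> zmodType) :
  (forall i, iso (T i) (U i)) -> iso (dprod T) (dprod U).
Proof.
move=> TU; pose f i := sval (cid (TU i)).
have fb i : bijective (f i) := svalP (cid (TU i)).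
pose F (x : dprod T) : dprod U := fun i => f i (x i).
have FB : zmod_morphism F.
  move=> x y; apply: functional_extensionality_dep => i.
  exact: (raddfB (f i) (x i) (y i)).
exists (additive_of FB); apply: inj_surj_bij.
  move=> x y /= e; apply: functional_extensionality_dep => i.
  exact: (bij_inj (fb i)) (congr1 (fun z : dprod U => z i) e).
move=> y; pose x i := sval (cid (bij_surj (fb i) (y i))).
exists x; apply: functional_extensionality_dep => i.
exact: svalP (cid (bij_surj (fb i) (y i))).
Qed.

(** * Cohomology classes and the long exact sequence *)

Section Classes.
Variables (X : cochain_complex) (n : nat).

Definition cls (z : cocycle X n) : cohomology X n := \pi_(cohomology X n)%qT z.

Lemma cls_surj (h : cohomology X n) : exists z, cls z = h.
Proof. by exists (generic_quotient.repr h); rewrite /cls reprK. Qed.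

Lemma cls0 : cls 0 = 0.
Proof. exact: (raddf0 (\pi_(cohomology X n)%qT)). Qed.

Lemma clsB (z z' : cocycle X n) : cls (z - z') = cls z - cls z'.
Proof. exact: (raddfB (\pi_(cohomology X n)%qT)). Qed.

Lemma cls_eq0 (z : cocycle X n) : cls z = 0 <-> is_coboundary (val z).
Proof.
have -> : (cls z = 0) <-> z \in @coboundary_pred X n.
  rewrite -[X in X \in _](subr0 z) Quotient.idealrBE -cls0.
  by split=> [/eqP|h]; [|apply/eqP].
by rewrite unfold_in; split=> /asboolP.
Qed.

Lemma cls_eq (z z' : cocycle X n) :
  cls z = cls z' <-> is_coboundary (val z - val z').
Proof.
rewrite -[_ - _]/(val (z - z')) -cls_eq0 clsB.
by split=> [->|/eqP]; rewrite ?subrr // subr_eq0 => /eqP.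
Qed.

Definition mkcocycle (x : X n) (dx : cc_diff X n x = 0) : cocycle X n :=
  Cocycle (introT eqP dx : x \in cocycle_pred (X := X) (n := n)).

Lemma cocycle_diff (z : cocycle X n) : cc_diff X n (val z) = 0.
Proof. exact/eqP/(cocycleP z). Qed.

End Classes.

Lemma cohomology_map_cls (X Y : cochain_complex) (f : chain_map X Y) n
    (z : cocycle X n) :
  cohomology_map f n (cls z) = cls (cocycle_map f z).
Proof. exact: cohomology_mapE. Qed.

Definition cohomology_hom (X Y : cochain_complex) (f : chain_map X Y) n :
    {additive cohomology X n -> cohomology Y n} := cohomology_map f n.

Section LongExact.
Variables (X Y Z : cochain_complex) (i : chain_map X Y) (q : chain_map Y Z).
Hypothesis iI : forall n, injective (i n).
Hypothesis qS : forall n z, exists y, q n y = z.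
Hypothesis iq : forall n, exact_at (i n) (q n).

Let qi n x : q n (i n x) = 0. Proof. by apply/iq; exists x. Qed.

Lemma les_middle n : exact_at (cohomology_map i n) (cohomology_map q n).
Proof.
move=> h; have [y <-] := cls_surj h; split; last first.
  case=> h'; have [x <-] := cls_surj h'; rewrite cohomology_map_cls => <-.
  rewrite cohomology_map_cls; apply/cls_eq0; rewrite /= qi.
  by case: (n) => //= m; exists 0; rewrite raddf0.
rewrite cohomology_map_cls => /cls_eq0 /= b.
have [y' [x [xy b']]] : exists y' x, i n x = val y - y' /\ is_coboundary y'.
  case: n y b {h} => [|m] y /=.
    by move=> /iq[x xy]; exists 0, x; rewrite subr0.
  case=> z zy; have [y' y'z] := qS z.
  have /iq[x xy] : q m.+1 (val y - cc_diff Y m y') = 0.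
    by rewrite raddfB /= -zy -y'z cm_comm subrr.
  by exists (cc_diff Y m y'), x; split=> //; exists y'.
have dx : cc_diff X n x = 0.
  apply: iI; rewrite -cm_comm xy raddfB /= cocycle_diff raddf0 sub0r.
  case: n y' b' {y x b xy h} => [|m] y' /=; first by move->; rewrite !raddf0.
  by case=> u <-; rewrite cc_diffK oppr0.
exists (cls (mkcocycle dx)); rewrite cohomology_map_cls; apply/cls_eq => /=.
rewrite xy addrAC subrr sub0r -sub0r; apply: is_coboundaryB => //.
by case: (n) => //= m; exists 0; rewrite raddf0.
Qed.

Let lift n (z : cocycle Z n) : exists (y : Y n) (x : cocycle X n.+1),
  q n y = val z /\ i n.+1 (val x) = cc_diff Y n y.
Proof.
have [y yz] := qS (val z).
have /iq[x xy] : q n.+1 (cc_diff Y n y) = 0 by rewrite -cm_comm yz cocycle_diff.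
have dx : cc_diff X n.+1 x = 0.
  by apply: iI; rewrite -cm_comm xy cc_diffK raddf0.
by exists y, (mkcocycle dx).
Qed.

Lemma connecting_exists n :
  exists delta : {additive cohomology Z n -> cohomology X n.+1},
    forall (y : Y n) (z : cocycle Z n) (x : cocycle X n.+1),
      q n y = val z -> i n.+1 (val x) = cc_diff Y n y -> delta (cls z) = cls x.
Proof.
pose R a b := exists (y : Y n) (z : cocycle Z n) (x : cocycle X n.+1),
  [/\ q n y = val z, i n.+1 (val x) = cc_diff Y n y, cls z = a & cls x = b].
have [] := @additive_of_rel _ _ R.
- move=> a; have [z za] := cls_surj a; have [y [x [yz xy]]] := lift z.
  by exists (cls x), y, z, x.
- move=> a a' b b' [y [z [x [yz xy <- <-]]]] [y' [z' [x' [yz' xy' <- <-]]]].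
  exists (y - y'), (z - z'), (x - x').
  by split; rewrite ?clsB // !raddfB /= ?yz ?yz' ?xy ?xy'.
- move=> {R} b [y [z [x [yz xy /cls_eq0 za <-]]]]; apply/cls_eq0 => /=.
  have [u yu] : exists u, q n u = 0 /\ cc_diff Y n u = cc_diff Y n y.
    case: n y z x yz xy za {b} => [|m] y z x yz xy /= b0.
      by exists y; split=> //; rewrite yz.
    case: b0 => w wz; have [v vw] := qS w; exists (y - cc_diff Y m v).
    split; last by rewrite raddfB /= cc_diffK subr0.
    by rewrite raddfB /= yz -[val z]wz -vw cm_comm subrr.
  case: yu => /iq[v vu] du; exists v; apply: iI.
  by rewrite -cm_comm vu du.
by move=> f fP; exists f => y z x yz xy; apply: fP; exists y, z, x.
Qed.

Definition connecting n := sval (cid (connecting_exists n)).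

(** The connecting map is computed by every lift [y], not only by a chosen one;
    the comparison with exterior cohomology relies on explicit lifts. *)
Lemma connectingE n (y : Y n) (z : cocycle Z n) (x : cocycle X n.+1) :
  q n y = val z -> i n.+1 (val x) = cc_diff Y n y ->
  connecting n (cls z) = cls x.
Proof. exact: (svalP (cid (connecting_exists n))). Qed.

Lemma les_right n : exact_at (cohomology_map q n) (connecting n).
Proof.
move=> h; have [z <-] := cls_surj h; split; last first.
  case=> h'; have [y <-] := cls_surj h'; rewrite cohomology_map_cls => <-.
  rewrite (@connectingE _ (val y) _ 0) //; first exact: cls0.
  by rewrite cocycle_diff raddf0.
have [y [x [yz xy]]] := lift z; rewrite (connectingE yz xy) => /cls_eq0[/= w wx].
have dy : cc_diff Y n (y - i n w) = 0 by rewrite raddfB /= cm_comm wx -xy subrr.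
exists (cls (mkcocycle dy)); rewrite cohomology_map_cls; congr cls; apply: val_inj.
by rewrite /= raddfB /= qi subr0.
Qed.

Lemma les_left n : exact_at (connecting n) (cohomology_map i n.+1).
Proof.
move=> h; have [x <-] := cls_surj h; split; last first.
  case=> h'; have [z <-] := cls_surj h'; have [y [w [yz wy]]] := lift z.
  rewrite (connectingE yz wy) => <-; rewrite cohomology_map_cls.
  by apply/cls_eq0; exists y; rewrite -wy.
rewrite cohomology_map_cls => /cls_eq0[/= y yx].
have dz : cc_diff Z n (q n y) = 0 by rewrite cm_comm yx qi.
by exists (cls (mkcocycle dz)); apply: connectingE (y) _ _ _ _.
Qed.

End LongExact.

(** * Maps of modules and of their cochains *)

Record gmap (G : groupType) (M N : gmodType G) := Gmap {
  gmap_fun :> {additive M -> N};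
  gmap_act : forall s x, gmap_fun (gact s x) = gact s (gmap_fun x)
}.

Definition mkgmap (G : groupType) (M N : gmodType G) (f : M -> N)
    (fB : zmod_morphism f) (fA : forall s x, f (gact s x) = gact s (f x)) :
  gmap M N := @Gmap G M N (additive_of fB) fA.

Section Cochains.
Variables (G : groupType) (M : gmodType G) (n : nat).

Definition mkcochain (f : ('I_n.+1 -> G) -> M)
    (fE : forall s g, f (fun i => s * g i)%g = gact s (f g)) : cochain M n :=
  @Cochain G M n f (introT (asboolP _) fE).

Lemma cochainB (f f' : cochain M n) g : (f - f') g = f g - f' g.
Proof. by rewrite -[LHS]/(val (f - f') g) raddfB. Qed.

Lemma cochain0 g : (0 : cochain M n) g = 0.
Proof. by rewrite -[LHS]/(val 0 g) raddf0. Qed.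

Lemma cochain_ext (f f' : cochain M n) : (forall g, f g = f' g) -> f = f'.
Proof. by move=> ff'; apply: val_inj; apply/funext. Qed.

End Cochains.

Section CochainMap.
Variables (G : groupType) (M N : gmodType G) (phi : gmap M N).

Fact cochain_map_equivariant n (f : cochain M n) s (g : 'I_n.+1 -> G) :
  phi (f (fun i => s * g i)%g) = gact s (phi (f g)).
Proof. by rewrite cochain_equivariant gmap_act. Qed.

Definition cochain_map n (f : cochain M n) : cochain N n :=
  mkcochain (cochain_map_equivariant f).

Fact cochain_map_zmod_morphism n : zmod_morphism (@cochain_map n).
Proof.
by move=> f f'; apply: cochain_ext => g; rewrite cochainB -raddfB -cochainB.
Qed.

Fact cochain_map_comm n (f : cochain M n) :
  cochain_diff (cochain_map f) = cochain_map (cochain_diff f).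
Proof.
apply: cochain_ext => g; rewrite /= /coface_sum raddf_sum.
by apply: eq_bigr => j _; rewrite raddfMz.
Qed.

Definition complex_map : chain_map (group_complex M) (group_complex N) :=
  @ChainMap (group_complex M) (group_complex N)
    (fun n => additive_of (@cochain_map_zmod_morphism n)) cochain_map_comm.

Definition Hmap k : {additive Hgrp k G M -> Hgrp k G N} :=
  cohomology_hom complex_map k.

Lemma Hmap_bij k : bijective phi -> bijective (Hmap k).
Proof.
move=> [psi phiK psiK].
have psiB : zmod_morphism psi.
  by move=> x y; apply: (can_inj phiK); rewrite raddfB !psiK.
have psiA s x : psi (gact s x) = gact s (psi x).
  by apply: (can_inj phiK); rewrite gmap_act !psiK.
have E n (f : cochain N n) s (g : 'I_n.+1 -> G) :
    psi (f (fun i => s * g i)%g) = gact s (psi (f g)).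
  by rewrite cochain_equivariant psiA.
have dE n (f : cochain N n) :
    cochain_diff (mkcochain (@E n f)) = mkcochain (@E _ (cochain_diff f)).
  apply: cochain_ext => g; apply: (can_inj phiK) => /=.
  rewrite psiK /coface_sum raddf_sum; apply: eq_bigr => j _.
  by rewrite raddfMz /= psiK.
have mE n (f : cochain N n) : cochain_map (mkcochain (@E n f)) = f.
  by apply: cochain_ext => g; rewrite /= psiK.
have inv n : injective (@cochain_map n).
  move=> f f' e; apply: cochain_ext => g; apply: (can_inj phiK).
  by move/(congr1 (fun h : cochain N n => h g)): e.
apply: inj_surj_bij; first apply: additive_inj => h.
  have [z <-] := cls_surj h; rewrite [Hmap k _]cohomology_map_cls.
  move=> /cls_eq0 b; apply/cls_eq0; move: b; case: (k) z {h} => [|m] z /=.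
    by move=> z0; apply: inv; rewrite [LHS]z0 [RHS](raddf0 (complex_map 0)).
  case=> y yz; exists (mkcochain (@E m y)); apply: inv.
  by rewrite -cochain_map_comm mE yz.
move=> h; have [z <-] := cls_surj h.
have dz : cc_diff (group_complex M) k (mkcochain (@E k (val z))) = 0.
  apply: inv; rewrite [RHS](raddf0 (complex_map k.+1)) /= dE mE.
  exact: (cocycle_diff z).
exists (cls (mkcocycle dz)); rewrite [Hmap k _]cohomology_map_cls; congr cls.
by apply: val_inj => /=; rewrite mE.
Qed.

End CochainMap.

Section ShortExact.
Variables (G : groupType) (M N P : gmodType G) (i : gmap M N) (q : gmap N P).
Hypothesis iI : injective i.
Hypothesis qS : forall z, exists y, q y = z.
Hypothesis iq : exact_at i q.

Lemma cochain_map_inj n : injective (complex_map i n).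
Proof.
move=> f f' e; apply: cochain_ext => g; apply: iI.
by move/(congr1 (fun h : cochain N n => h g)): e.
Qed.

(** An equivariant function is freely determined by its values on the tuples
    that start with the identity, so it lifts along a section of [q] that need
    be neither additive nor equivariant. *)
Lemma cochain_map_surj n z : exists y, complex_map q n y = z.
Proof.
have [s sP] := choice qS.
have E t (g : 'I_n.+1 -> G) :
    gact (t * g ord0)%g (s (z (fun i => (t * g ord0)^-1 * (t * g i))%g)) =
    gact t (gact (g ord0) (s (z (fun i => (g ord0)^-1 * g i)%g))).
  rewrite gactM; congr (gact _ (gact _ (s (z _)))); apply/funext => j.
  by rewrite invgM -mulgA mulKg.
exists (mkcochain (f := fun g => gact (g ord0) (s (z (fun i => (g ord0)^-1 * g i)%g))) E).
apply: cochain_ext => g /=; rewrite gmap_act sP -cochain_equivariant.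
by congr (z _); apply/funext => j; rewrite mulVKg.
Qed.

Lemma cochain_map_exact n : exact_at (complex_map i n) (complex_map q n).
Proof.
move=> y; split=> [qy|[x <-]]; last first.
  by apply: cochain_ext => g; rewrite cochain0 /=; apply/iq; eexists.
have /choice[x xP] : forall g, exists x, i x = y g.
  move=> g; apply/iq.
  by rewrite -[LHS]/(complex_map q n y g) qy cochain0.
have xE s g : x (fun j => s * g j)%g = gact s (x g).
  by apply: iI; rewrite gmap_act !xP cochain_equivariant.
by exists (mkcochain xE); apply: cochain_ext => g /=.
Qed.

Definition Hconn k : {additive Hgrp k G P -> Hgrp k.+1 G M} :=
  connecting cochain_map_inj cochain_map_surj cochain_map_exact k.

Lemma HconnE k (y : cochain N k) (z : cocycle (group_complex P) k)
    (x : cocycle (group_complex M) k.+1) :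
  cochain_map q y = val z -> cochain_map i (val x) = cochain_diff y ->
  Hconn k (cls z) = cls x.
Proof.
exact: (@connectingE _ _ _ _ _ cochain_map_inj cochain_map_surj cochain_map_exact k y z x).
Qed.

Lemma Hles_middle k : exact_at (Hmap i k) (Hmap q k).
Proof. exact: les_middle cochain_map_inj cochain_map_surj cochain_map_exact k. Qed.

Lemma Hles_right k : exact_at (Hmap q k) (Hconn k).
Proof. exact: les_right. Qed.

Lemma Hles_left k : exact_at (Hconn k) (Hmap i k.+1).
Proof. exact: les_left. Qed.

End ShortExact.

Section Kernel.
Variables (G : groupType) (M N : gmodType G) (phi : gmap M N).

Definition gker_pred : {pred M} := fun x => phi x == 0.

Fact gker_zmod_closed : zmod_closed gker_pred.
Proof.
split=> [|x y]; rewrite !unfold_in ?raddf0 //.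
by move=> /eqP ex /eqP ey; rewrite raddfB /= ex ey subrr.
Qed.
HB.instance Definition _ := GRing.isZmodClosed.Build M gker_pred gker_zmod_closed.

Record gker := Gker { gker_val : M; gkerP : gker_val \in gker_pred }.
HB.instance Definition _ := [isSub for gker_val].
HB.instance Definition _ := [Choice of gker by <:].
HB.instance Definition _ := [SubChoice_isSubZmodule of gker by <:].

Lemma gker_eq0 (x : gker) : phi (gker_val x) = 0. Proof. exact/eqP/(gkerP x). Qed.

Fact gker_act_subproof s (x : gker) : gact s (gker_val x) \in gker_pred.
Proof. by rewrite unfold_in gmap_act gker_eq0 gact0. Qed.
Definition gker_act s (x : gker) : gker := Gker (gker_act_subproof s x).

Fact gker_act1 x : gker_act 1%g x = x.
Proof. by apply: val_inj; rewrite /= gact1. Qed.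
Fact gker_actM s t x : gker_act (s * t)%g x = gker_act s (gker_act t x).
Proof. by apply: val_inj; rewrite /= gactM. Qed.
Fact gker_actD s : {morph gker_act s : x y / x + y}.
Proof. by move=> x y; apply: val_inj; rewrite /= gactD. Qed.
HB.instance Definition _ := @Zmodule_isGmodule.Build G gker gker_act
  gker_act1 gker_actM gker_actD.

Fact gker_val_zmod_morphism : zmod_morphism gker_val.
Proof. by move=> x y; exact: (raddfB (val : gker -> M)). Qed.
Definition gker_incl : gmap gker M :=
  mkgmap gker_val_zmod_morphism (fun s x => erefl).

Lemma gker_incl_inj : injective gker_incl.
Proof. exact: val_inj. Qed.

Definition mkgker (x : M) (e : phi x = 0) : gker := Gker (introT eqP e : x \in gker_pred).

End Kernel.

(** * Alternating sums over tuples *)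

Section Coface.
Variables (T : Type) (N : zmodType).

(** The coboundary of the full simplex on [T]; on [n.+1]-tuples it is the
    differential of group cochains, on [0]-tuples the augmentation. *)
Definition cof n (f : ('I_n -> T) -> N) : ('I_n.+1 -> T) -> N :=
  fun t => \sum_(j < n.+1) f (t \o lift j) *~ (-1) ^+ j.

Definition tcons n (x : T) (t : 'I_n -> T) : 'I_n.+1 -> T :=
  fun i => if unlift ord0 i is Some j then t j else x.

Lemma tcons0 n x (t : 'I_n -> T) : tcons x t ord0 = x.
Proof. by rewrite /tcons unlift_none. Qed.

Lemma tconsS n x (t : 'I_n -> T) j : tcons x t (lift ord0 j) = t j.
Proof. by rewrite /tcons liftK. Qed.

Lemma tcons_lift0 n x (t : 'I_n -> T) : tcons x t \o lift ord0 = t.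
Proof. by apply/funext => j /=; rewrite tconsS. Qed.

Lemma tcons_eta n (t : 'I_n.+1 -> T) : t = tcons (t ord0) (t \o lift ord0).
Proof.
by apply/funext => i; case: (unliftP ord0 i) => [j|] ->; rewrite ?tcons0 ?tconsS.
Qed.

Lemma tcons_liftS n x (t : 'I_n.+1 -> T) j :
  tcons x t \o lift (lift ord0 j) = tcons x (t \o lift j).
Proof.
apply/funext => i /=; case: (unliftP ord0 i) => [k|] ->.
  have -> : lift (lift ord0 j) (lift ord0 k) = lift ord0 (lift j k).
    by apply: val_inj; rewrite /= /bump /=; lia.
  by rewrite !tconsS.
have -> : lift (lift ord0 j) ord0 = ord0 by apply: val_inj.
by rewrite !tcons0.
Qed.

Lemma cof_nullary (f : ('I_0 -> T) -> N) t u : cof f t = f u.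
Proof.
rewrite /cof big_ord_recl big_ord0 addr0 expr0.
by congr f; apply/funext; case.
Qed.

(** Recursion on the first entry replaces the arithmetic of face indices in
    everything that follows. *)
Lemma cof_cons n (f : ('I_n.+1 -> T) -> N) x t :
  cof f (tcons x t) = f t - cof (fun u => f (tcons x u)) t.
Proof.
rewrite /cof big_ord_recl tcons_lift0 expr0; congr (_ + _); rewrite -sumrN.
by apply: eq_bigr => j _; rewrite tcons_liftS /= /bump /= add1n exprS mulN1r mulrNz.
Qed.

Lemma cofB n (f g : ('I_n -> T) -> N) t :
  cof (fun u => f u - g u) t = cof f t - cof g t.
Proof. by rewrite /cof -sumrB; apply: eq_bigr => j _; rewrite mulrzBl. Qed.

Lemma cof_cof n (f : ('I_n -> T) -> N) t : cof (cof f) t = 0.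
Proof.
elim: n => [|n IH] in f t *; rewrite [t]tcons_eta cof_cons; set u := t \o _.
  rewrite (cof_nullary (fun v => cof f _) u (u \o lift ord0)).
  by rewrite !(cof_nullary f _ (u \o lift ord0)) subrr.
have -> : (fun v => cof f (tcons (t ord0) v)) =
    (fun v => f v - cof (fun w => f (tcons (t ord0) w)) v).
  by apply/funext => v; rewrite cof_cons.
by rewrite cofB IH subr0 subrr.
Qed.

(** The alternating sum over the mixed tuples [P x0, ..., P xi, xi, ..., xn],
    written by peeling off the first entry so that the homotopy formula below
    is proved by induction. *)
Fixpoint prism (P : T -> T) n : (('I_n.+1 -> T) -> N) -> ('I_n -> T) -> N :=
  match n with
  | 0 => fun _ _ => 0
  | m.+1 => fun f t => f (tcons (P (t ord0)) t) -
      prism P (fun u => f (tcons (P (t ord0)) u)) (t \o lift ord0)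
  end.

Lemma prism_cons P n (f : ('I_n.+2 -> T) -> N) x t :
  prism P f (tcons x t) =
  f (tcons (P x) (tcons x t)) - prism P (fun u => f (tcons (P x) u)) t.
Proof. by rewrite /= tcons0 tcons_lift0. Qed.

Lemma prismB P n (f g : ('I_n.+1 -> T) -> N) t :
  prism P (fun u => f u - g u) t = prism P f t - prism P g t.
Proof.
elim: n => [|n IH] in f g t *; first by rewrite /= subr0.
rewrite /= (IH (fun u => f (tcons _ u)) (fun u => g (tcons _ u))).
by rewrite !opprB addrACA [RHS]addrACA [- _ - _]addrC.
Qed.

Lemma prism0 P n t : prism P (fun _ : 'I_n.+1 -> T => 0) t = 0.
Proof. by elim: n t => [|n IH] t //=; rewrite IH subr0. Qed.

Lemma prism_homotopy P n (f : ('I_n.+1 -> T) -> N) t :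
  cof (prism P f) t + prism P (cof f) t = f t - f (P \o t).
Proof.
have PE m x (u : 'I_m -> T) : P \o tcons x u = tcons (P x) (P \o u).
  by apply/funext => i /=; case: (unliftP ord0 i) => [j|] ->; rewrite ?tcons0 ?tconsS.
elim: n => [|n IH] in f t *; rewrite [t]tcons_eta PE; move: (t ord0) (t \o _) => x u.
  rewrite (cof_nullary _ _ u) add0r prism_cons /= subr0 cof_cons.
  by rewrite (cof_nullary _ _ u); congr (_ - f (tcons _ _)); apply/funext; case.
pose F v := f (tcons (P x) v).
have -> : prism P (cof f) (tcons x u) =
    f (tcons x u) - (F u - cof (fun v => F (tcons x v)) u) -
    (prism P f u - prism P (cof F) u).
  rewrite prism_cons cof_cons cof_cons; congr (_ - _ - _).
  by rewrite -prismB; congr (prism _ _ _); apply/funext => v; rewrite cof_cons.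
have -> : cof (prism P f) (tcons x u) =
    prism P f u - (cof (fun v => F (tcons x v)) u - cof (prism P F) u).
  rewrite cof_cons; congr (_ - _); rewrite -cofB.
  by congr cof; apply/funext => v; rewrite prism_cons.
have FP : f (tcons (P x) (P \o u)) = F u - (cof (prism P F) u + prism P (cof F) u).
  by rewrite IH opprB addrC subrK.
rewrite {}FP; move: (F u) (prism P f u) (f _) => a b c.
move: (cof (prism P F) u) (prism P (cof F) u) (cof _ u) => d e g.
rewrite !opprB !addrA [LHS](ACl ((1*8)*(3*5)*(4*((2*7)*6)))) /=.
by rewrite subrr addNr !add0r !addrA.
Qed.

(** The same coboundary for functions of all finite sequences, whose arguments
    can be concatenated without any bookkeeping of lengths. *)
Fixpoint scof (f : seq T -> N) (s : seq T) : N :=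
  if s is x :: s' then f s' - scof (fun u => f (x :: u)) s' else 0.

Lemma eq_scof n (f f' : seq T -> N) s :
  (forall u, size u = n -> f u = f' u) -> size s = n.+1 -> scof f s = scof f' s.
Proof.
elim: s n f f' => [|x s IH] n f f' ff' //= [sn]; rewrite ff' //; congr (_ - _).
case: n sn ff' => [/size0nil -> //|n] sn ff'.
by apply: IH sn => u un; apply: ff'; rewrite /= un.
Qed.

Lemma scof_cat f s1 s2 : scof f (s1 ++ s2) =
  scof (fun u => f (u ++ s2)) s1 + scof (fun u => f (s1 ++ u)) s2 *~ (-1) ^+ size s1.
Proof.
elim: s1 f => [|x s1 IH] f /=; first by rewrite add0r expr0.
by rewrite IH exprS mulN1r mulrNz opprD addrA.
Qed.

Variable x0 : T.
Definition tup n (s : seq T) : 'I_n -> T := fun i => nth x0 s i.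
Arguments tup n s i : clear implicits.

Lemma codom_tcons n x (t : 'I_n -> T) : codom (tcons x t) = x :: codom t.
Proof.
rewrite /codom /image_mem !enumT -!enumT enum_ordSl /= tcons0 -map_comp.
by congr (_ :: _); apply: eq_map => i /=; rewrite tconsS.
Qed.

Lemma size_codom_ord n (t : 'I_n -> T) : size (codom t) = n.
Proof. by rewrite size_codom card_ord. Qed.

Lemma codomK n (t : 'I_n -> T) : tup n (codom t) = t.
Proof.
apply/funext => i; rewrite /tup /codom /image_mem (nth_map i) ?size_enum_ord //.
by rewrite nth_ord_enum.
Qed.

Lemma tupK n s : size s = n -> codom (tup n s) = s.
Proof.
move=> sn; apply: (@eq_from_nth _ x0); rewrite size_codom_ord // => i ni.
by rewrite -[LHS]/(tup n (codom (tup n s)) (Ordinal ni)) codomK.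
Qed.

Lemma tup_cons n x s : tup n.+1 (x :: s) = tcons x (tup n s).
Proof.
by apply/funext => i; case: (unliftP ord0 i) => [j|] ->; rewrite ?tcons0 ?tconsS.
Qed.

Lemma cof_scof n (f : ('I_n -> T) -> N) t :
  cof f t = scof (fun s => f (tup n s)) (codom t).
Proof.
elim: n => [|n IH] in f t *; rewrite [t]tcons_eta codom_tcons.
  by rewrite /codom /image_mem enum_ord0 /= subr0; apply: cof_nullary.
rewrite cof_cons /= codomK IH; congr (_ - scof _ _).
by apply/funext => s; rewrite tup_cons.
Qed.

End Coface.

Arguments tup {T} x0 n s i.

(** * Alternating functions *)

Section Alternates.
Variables (T : Type) (N : zmodType).

(** Stated for all transpositions, so that it passes at once to functions of
    some of the variables. *)
Definition alternates n (a : ('I_n -> T) -> N) : Prop :=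
  forall i j : 'I_n, i != j ->
    (forall g, g i = g j -> a g = 0) /\ (forall g, a (g \o tperm i j) = - a g).

Lemma alternates_perm n (a : ('I_n -> T) -> N) (s : 'S_n) g :
  alternates a -> a (g \o s) = a g *~ (-1) ^+ s.
Proof.
move=> Aa; have [ts -> /=] := prod_tpermP s.
elim: ts g => [|[i j] ts IH] g /= => [_|/andP[ij dts]].
  rewrite big_nil odd_perm1 expr0; congr a.
  by apply/funext => i /=; rewrite perm1.
rewrite big_cons odd_permM odd_tperm ij signr_addb expr1 mulN1r mulrNz -IH //.
rewrite -(Aa i j ij).2; congr a; apply/funext => k /=.
by rewrite permM.
Qed.

Lemma alternates_eq0 n (a : ('I_n -> T) -> N) g :
  alternates a -> ~ injective g -> a g = 0.
Proof.
move=> Aa ng; apply: contrapT => ag; apply: ng => i j gij.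
by have [//|ij] := eqVneq i j; case: ag; apply: (Aa i j ij).1.
Qed.

(** A permutation also permutes the omitted positions. The sign of the
    permutation induced on the others makes up for the sign of the face. *)
Lemma lift_perm_fun n (s : 'S_n.+1) (j : 'I_n.+1) : exists s' : 'S_n,
  s \o lift j = lift (s j) \o s' /\ (s : bool) = odd j (+) odd (s j) (+) s'.
Proof.
have f_ex k : exists l, s (lift j k) = lift (s j) l.
  case: (unliftP (s j) (s (lift j k))) => [l ->|/perm_inj e]; first by exists l.
  by have := neq_lift j k; rewrite e eqxx.
have [f fP] := choice f_ex.
have fI : injective f.
  move=> k l e; have := fP k; rewrite e -fP => /perm_inj.
  exact: lift_inj.
have E : s = lift_perm j (s j) (perm fI).
  apply/permP => i; case: (unliftP j i) => [k|] ->; last by rewrite lift_perm_id.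
  by rewrite lift_perm_lift permE fP.
exists (perm fI); split; first by apply/funext => k /=; rewrite fP permE.
by rewrite {1}E odd_lift_perm.
Qed.

Lemma cof_alternates n (a : ('I_n -> T) -> N) : alternates a -> alternates (cof a).
Proof.
move=> Aa i j ij; pose s := tperm i j.
have step g (k : 'I_n.+1) :
    a ((g \o s) \o lift k) *~ (-1) ^+ k = - (a (g \o lift (s k)) *~ (-1) ^+ s k).
  have [s' [e o]] := lift_perm_fun s k.
  rewrite -compA e compA alternates_perm // -mulrzA -mulrNz; congr (_ *~ _).
  have : (s : bool) = true by rewrite odd_tperm ij.
  rewrite o -[_ ^+ k]signr_odd -[_ ^+ s k]signr_odd.
  by case: (odd k); case: (odd (s k)); case: (s' : bool).
split=> g; last first.
  rewrite /cof (eq_bigr _ (fun k _ => step g k)) sumrN; congr (- _).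
  by rewrite [RHS](reindex_inj (@perm_inj _ (tperm i j))).
move=> gij; rewrite /cof (bigD1 i) //= (bigD1 j) /=; last by rewrite eq_sym.
rewrite big1 ?addr0 => [|k /andP[ki kj]].
  have gE : g \o s = g by apply/funext => k /=; rewrite /s; case: tpermP => // ->.
  by have := step g i; rewrite gE /s tpermL => ->; rewrite addNr.
have [i1 e1 _] := unlift_some ki; have [j1 e2 _] := unlift_some kj.
have ij' : i1 != j1 by apply: contra ij => /eqP e; rewrite e1 e2 e.
by rewrite (Aa _ _ ij').1 ?mul0rz //= -e1 -e2.
Qed.

Lemma tcons_alternates n (a : ('I_n.+1 -> T) -> N) x :
  alternates a -> alternates (fun t => a (tcons x t)).
Proof.
move=> Aa i j ij; have ij' : lift ord0 i != lift ord0 j by rewrite (inj_eq lift_inj).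
split=> g; first by move=> e; apply: (Aa _ _ ij').1; rewrite !tconsS.
rewrite -(Aa _ _ ij').2; congr a; apply/funext => k /=.
case: (unliftP ord0 k) => [l|] ->; rewrite ?tcons0.
  by rewrite -(inj_tperm _ _ _ (@lift_inj _ ord0)) !tconsS.
by rewrite tpermD ?tcons0 // eq_sym neq_lift.
Qed.

(** Every transposition arises from an adjacent one by successive conjugations
    with adjacent ones, each of which changes the sign twice. *)
Lemma adjacent_alternates n (a : ('I_n.+1 -> T) -> N) :
  (forall i : 'I_n, (forall g, g (pos i) = g (succ_pos i) -> a g = 0) /\
     (forall g, a g = - a (g \o tperm (pos i) (succ_pos i)))) ->
  alternates a.
Proof.
move=> adj.
have adj' (i j : 'I_n.+1) : i.+1 = j :> nat ->
    (forall g, g i = g j -> a g = 0) /\ (forall g, a (g \o tperm i j) = - a g).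
  move=> ij; have ni : (i < n)%N by have := ltn_ord j; lia.
  have -> : i = pos (Ordinal ni) by apply: val_inj.
  have -> : j = succ_pos (Ordinal ni) by apply: val_inj; rewrite /= -ij.
  by have [h1 h2] := adj (Ordinal ni); split=> // g; rewrite [a g]h2 opprK.
have lt d (i j : 'I_n.+1) : (i + d.+1 = j)%N ->
    (forall g, g i = g j -> a g = 0) /\ (forall g, a (g \o tperm i j) = - a g).
  elim: d j => [|d IH] j ij; first by apply: adj'; lia.
  have nj : (i + d.+1 < n.+1)%N by have := ltn_ord j; lia.
  pose k := Ordinal nj; have [k1 k2] := IH k erefl.
  have kj : k.+1 = j :> nat by rewrite /=; lia.
  have [j1 j2] := adj' k j kj.
  have ik : i != k by rewrite -val_eqE /=; lia.
  have ij' : i != j by rewrite -val_eqE /=; lia.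
  have kj' : k != j by rewrite -val_eqE /=; lia.
  split=> g.
    move=> e; apply: oppr_inj; rewrite oppr0 -j2; apply: k1 => /=.
    by rewrite tpermL tpermD // eq_sym.
  rewrite -j2 -[RHS]opprK -k2 -j2; congr a; apply/funext => l /=.
  congr g; rewrite -!permM; congr (fun_of_perm _ l).
  have := tpermJ i k (tperm k j); rewrite tpermD ?tpermL // 1?eq_sym // => <-.
  by rewrite conjgE tpermV mulgA.
move=> i j; rewrite -val_eqE /= neq_ltn => /orP[ij|ij].
  by apply: (lt (j - i.+1)%N); lia.
have [h1 h2] : (forall g, g j = g i -> a g = 0) /\ (forall g, a (g \o tperm j i) = - a g).
  by apply: (lt (i - j.+1)%N); lia.
by split=> g; [move=> e; apply: h1|rewrite tpermC].
Qed.

End Alternates.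

Section AlternatingModule.
Variables (G : groupType) (M : gmodType G).

Section Degree.
Variable n : nat.

Definition alt_pred : {pred ('I_n -> G) -> M} := fun a => `[< alternates a >].

Fact alt_zmod_closed : zmod_closed alt_pred.
Proof.
split=> [|a b]; rewrite !unfold_in.
  by apply/asboolP => i j _; split=> g //; rewrite [RHS]oppr0.
move=> /asboolP Aa /asboolP Ab; apply/asboolP => i j ij.
have [a0 aN] := Aa i j ij; have [b0 bN] := Ab i j ij.
have E g : (a - b) g = a g - b g by [].
by split=> g; rewrite !E ?aN ?bN ?opprD // => e; rewrite a0 // b0 // subrr.
Qed.
HB.instance Definition _ :=
  GRing.isZmodClosed.Build (('I_n -> G) -> M) alt_pred alt_zmod_closed.

Record altfun := AltFun {
  altfun_val :> ('I_n -> G) -> M;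
  altfunP : altfun_val \in alt_pred
}.
HB.instance Definition _ := [isSub for altfun_val].
HB.instance Definition _ := [Choice of altfun by <:].
HB.instance Definition _ := [SubChoice_isSubZmodule of altfun by <:].

Lemma altfun_alternates (a : altfun) : alternates a.
Proof. exact/asboolP/(altfunP a). Qed.

Definition mkaltfun (a : ('I_n -> G) -> M) (Aa : alternates a) : altfun :=
  @AltFun a (introT (asboolP _) Aa).

Lemma altfun_ext (a b : altfun) : (forall g, a g = b g) -> a = b.
Proof. by move=> ab; apply: val_inj; apply/funext. Qed.

Lemma altfunB (a b : altfun) g : (a - b) g = a g - b g.
Proof. by rewrite -[LHS]/(val (a - b) g) raddfB. Qed.

Lemma altfun0 g : (0 : altfun) g = 0.
Proof. by rewrite -[LHS]/(val 0 g) raddf0. Qed.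

Fact alt_act_subproof s (a : altfun) :
  alternates (fun g => gact s (a (fun i => s^-1 * g i)%g)).
Proof.
move=> i j ij; have [a0 aN] := altfun_alternates a ij; split=> g.
  by move=> e; rewrite a0 ?gact0 // e.
by rewrite -gactN -aN.
Qed.
Definition alt_act s (a : altfun) : altfun := mkaltfun (alt_act_subproof s a).

Fact alt_act1 a : alt_act 1%g a = a.
Proof.
apply: altfun_ext => g /=; rewrite gact1; congr (altfun_val a _).
by apply/funext => i; rewrite invg1 mul1g.
Qed.
Fact alt_actM s t a : alt_act (s * t)%g a = alt_act s (alt_act t a).
Proof.
apply: altfun_ext => g /=; rewrite gactM; congr (gact _ (gact _ (altfun_val a _))).
by apply/funext => i; rewrite invgM mulgA.
Qed.
Fact alt_actD s : {morph alt_act s : a b / a + b}.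
Proof.
move=> a b; apply: altfun_ext => g.
have E (c d : altfun) h : (c + d) h = c h + d h.
  by rewrite -[LHS]/(val (c + d) h) raddfD.
rewrite E [LHS]/(gact s ((a + b) _)) E; exact: gactD.
Qed.
HB.instance Definition _ := @Zmodule_isGmodule.Build G altfun alt_act
  alt_act1 alt_actM alt_actD.

Lemma alt_gactE s (a : altfun) g : gact s a g = gact s (a (fun i => s^-1 * g i)%g).
Proof. by []. Qed.

Lemma alt_gact_mul s (a : altfun) g : gact s a (fun i => s * g i)%g = gact s (a g).
Proof. by rewrite alt_gactE; congr (gact s (a _)); apply/funext => i; rewrite mulKg. Qed.

End Degree.

Definition alt_diff n (a : altfun n) : altfun n.+1 :=
  mkaltfun (cof_alternates (altfun_alternates a)).

Fact alt_diff_zmod_morphism n : zmod_morphism (@alt_diff n).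
Proof.
move=> a b; apply: altfun_ext => g; rewrite altfunB /= -cofB.
by congr cof; apply/funext => u; rewrite altfunB.
Qed.

Lemma gact_cof (T : Type) n (f : ('I_n -> T) -> M) s g :
  gact s (cof f g) = cof (fun u => gact s (f u)) g.
Proof.
rewrite /cof (big_morph (gact s) (gactD s) (gact0 M s)); apply: eq_bigr => j _.
by rewrite -signr_odd; case: (odd j); rewrite ?expr1 ?expr0 ?mulrNz ?gactN.
Qed.

Fact alt_diff_act n s (a : altfun n) : alt_diff (gact s a) = gact s (alt_diff a).
Proof. by apply: altfun_ext => g; rewrite alt_gactE /= gact_cof. Qed.

Definition Altd n : gmap (altfun n) (altfun n.+1) :=
  mkgmap (@alt_diff_zmod_morphism n) (@alt_diff_act n).

(** Homomorphisms into [M] from the syzygies of the exterior resolution of the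
    integers: the coefficients through which dimension shifting passes. *)
Definition Altz n : gmodType G := gker (Altd n).

Definition Altz_incl n : gmap (Altz n) (altfun n) := gker_incl (Altd n).

Fact Altd_cocycle n (a : altfun n) : Altd n.+1 (Altd n a) = 0.
Proof. by apply: altfun_ext => g; rewrite altfun0 /= cof_cof. Qed.

Definition Altq_fun n (a : altfun n) : Altz n.+1 := mkgker (Altd_cocycle a).

Fact Altq_zmod_morphism n : zmod_morphism (@Altq_fun n).
Proof. by move=> a b; apply: gker_incl_inj; rewrite raddfB /= alt_diff_zmod_morphism. Qed.

Fact Altq_act n s (a : altfun n) : Altq_fun (gact s a) = gact s (Altq_fun a).
Proof. by apply: val_inj; rewrite /= alt_diff_act. Qed.

Definition Altq n : gmap (altfun n) (Altz n.+1) :=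
  mkgmap (@Altq_zmod_morphism n) (@Altq_act n).

(** Setting the first variable to the identity contracts the alternating
    complex. The contraction is not equivariant: the complex is exact, but its
    complex of invariants need not be. *)
Lemma Altq_surj n z : exists a, Altq n a = z.
Proof.
have Az := tcons_alternates 1%g (altfun_alternates (gker_val z)).
exists (mkaltfun Az); apply: val_inj; apply: altfun_ext => g /=.
have /(congr1 (fun a : altfun _ => a (tcons 1%g g))) := gker_eq0 z.
by rewrite altfun0 /= cof_cons => /eqP; rewrite subr_eq0 => /eqP.
Qed.

Lemma Alt_exact n : exact_at (Altz_incl n) (Altq n).
Proof.
move=> a; split=> [e|[z <-]]; last first.
  by apply: val_inj; have := gker_eq0 z; rewrite raddf0.
have da : Altd n a = 0 by have := congr1 (gker_incl _) e; rewrite raddf0.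
by exists (mkgker da).
Qed.

Definition Altconn n k : {additive Hgrp k G (Altz n.+1) -> Hgrp k.+1 G (Altz n)} :=
  Hconn (@gker_incl_inj _ _ _ (Altd n)) (@Altq_surj n) (@Alt_exact n) k.

Lemma Alt_les_middle n k : exact_at (Hmap (Altz_incl n) k) (Hmap (Altq n) k).
Proof.
exact: Hles_middle (@gker_incl_inj _ _ _ (Altd n)) (@Altq_surj n) (@Alt_exact n) k.
Qed.

Lemma Alt_les_right n k : exact_at (Hmap (Altq n) k) (Altconn n k).
Proof. exact: Hles_right. Qed.

Lemma Alt_les_left n k : exact_at (Altconn n k) (Hmap (Altz_incl n) k.+1).
Proof. exact: Hles_left. Qed.

End AlternatingModule.
Arguments Altd {G} M n.
Arguments Altz {G} M n.
Arguments Altz_incl {G} M n.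
Arguments Altq {G} M n.
Arguments Altconn {G} M n k.

(** * Homotopies on cochains with alternating coefficients *)

Section AltCochains.
Variables (G : groupType) (M : gmodType G).
Implicit Types (n k : nat).

Lemma altcochain_diffE n k (f : cochain (altfun M n) k) h g :
  cochain_diff f h g = cof (fun u => f u g) h.
Proof.
rewrite /= /coface_sum /cof.
have ev : zmod_morphism (fun a : altfun M n => a g) by move=> a b; rewrite altfunB.
rewrite -[LHS]/(additive_of ev _) raddf_sum; apply: eq_bigr => j _.
by rewrite raddfMz.
Qed.

Lemma altcochain_equivariant n k (f : cochain (altfun M n) k) s h g :
  f (fun i => s * h i)%g (fun i => s * g i)%g = gact s (f h g).
Proof. by rewrite cochain_equivariant alt_gact_mul. Qed.

Section Make.
Variables (n k : nat) (F : ('I_k.+1 -> G) -> ('I_n -> G) -> M).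
Hypothesis FA : forall h, alternates (F h).
Hypothesis FE : forall s h g,
  F (fun i => s * h i)%g (fun i => s * g i)%g = gact s (F h g).

Fact altcochain_subproof s h :
  mkaltfun (FA (fun i => s * h i)%g) = gact s (mkaltfun (FA h)).
Proof.
apply: altfun_ext => g; rewrite alt_gactE /= -FE; congr (F _ _).
by apply/funext => i; rewrite mulVKg.
Qed.
Definition altcochain : cochain (altfun M n) k := mkcochain altcochain_subproof.

End Make.

Lemma altcocycle_cof n k (z : cocycle (group_complex (altfun M n)) k) h g :
  cof (fun u => val z u g) h = 0.
Proof.
by rewrite -altcochain_diffE [cochain_diff _](cocycle_diff z) cochain0 altfun0.
Qed.

(** The tuple [h] is the first face of [x, h], and all other faces of [x, h]
    are cones with apex [x] again. *)
Lemma altcocycle_cone n k (z : cocycle (group_complex (altfun M n)) k) x h g :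
  cof (fun u => val z (tcons x u) g) h = val z h g.
Proof.
have := altcocycle_cof z (tcons x h) g; rewrite cof_cons => /eqP.
by rewrite subr_eq0 => /eqP.
Qed.

Lemma tcons_mul k s x (h : 'I_k -> G) :
  (fun i => s * tcons x h i)%g = tcons (s * x)%g (fun i => s * h i)%g.
Proof.
by apply/funext => i; case: (unliftP ord0 i) => [j|] ->; rewrite ?tcons0 ?tconsS.
Qed.

Lemma altcochain_ninj n k (f : cochain (altfun M n) k) h g :
  ~ injective g -> f h g = 0.
Proof. by move=> ng; apply: alternates_eq0 ng; apply: altfun_alternates. Qed.

Lemma alternates_inj n (F : ('I_n -> G) -> M) :
  (forall g, ~ injective g -> F g = 0) ->
  (forall i j g, i != j -> injective g -> F (g \o tperm i j) = - F g) ->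
  alternates F.
Proof.
move=> F0 FN i j ij; split=> g.
  by move=> gij; apply: F0 => gI; rewrite (gI _ _ gij) eqxx in ij.
have [gI|ng] := pselect (injective g); first exact: FN.
rewrite !F0 ?oppr0 // => gI; apply: ng => x y e.
by apply: (@perm_inj _ (tperm i j)); apply: gI; rewrite /= !tpermK.
Qed.

Lemma inj_mulg n s (g : 'I_n -> G) : injective (fun i => s * g i)%g <-> injective g.
Proof.
split=> gI i j e; apply: gI; first by rewrite e.
exact: mulgI e.
Qed.

(** The sum of the cones with apexes [pts g] is a null-homotopy of [m].
    Equivariance of [pts] makes it an equivariant cochain, and symmetry makes
    its values alternate; both concern subsets only, because alternating
    functions vanish on tuples with repeated entries. *)
Lemma altcoh_cone n m k (pts : ('I_n -> G) -> seq G) (x : Hgrp k.+1 G (altfun M n)) :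
  (forall g, injective g -> size (pts g) = m) ->
  (forall s g, injective g -> pts (fun i => s * g i)%g = [seq s * y | y <- pts g]%g) ->
  (forall g i j, injective g -> perm_eq (pts (g \o tperm i j)) (pts g)) ->
  x *+ m = 0.
Proof.
move=> pm pE pS; have [z <-] := cls_surj x.
pose F (h : 'I_k.+1 -> G) g := \sum_(y <- pts g) val z (tcons y h) g.
have FA h : alternates (F h).
  apply: alternates_inj => [g ng|i j g ij gI].
    by apply: big1 => y _; apply: altcochain_ninj.
  rewrite /F (perm_big _ (pS g i j gI)) /= -sumrN; apply: eq_bigr => y _.
  by rewrite (altfun_alternates _ ij).2.
have FE s h g : F (fun i => s * h i)%g (fun i => s * g i)%g = gact s (F h g).
  have [gI|ng] := pselect (injective g); last first.
    rewrite /F !big1 ?gact0 // => y _; apply: altcochain_ninj => //.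
    by move/inj_mulg.
  rewrite /F pE // big_map (big_morph (gact s) (gactD s) (gact0 M s)).
  by apply: eq_bigr => y _; rewrite -tcons_mul altcochain_equivariant.
rewrite /cls -raddfMn; apply/cls_eq0; exists (altcochain FA FE).
apply: cochain_ext => h; apply: altfun_ext => g.
rewrite [LHS]altcochain_diffE /= /F.
have -> : cof (fun u => \sum_(y <- pts g) val z (tcons y u) g) h =
    \sum_(y <- pts g) val z h g.
  rewrite {1}/cof; under eq_bigr do rewrite mulrz_suml.
  rewrite exchange_big; apply: eq_bigr => y _ /=.
  by rewrite -(altcocycle_cone z y).
have -> : cocycle_val (z *+ m) = val z *+ m by rewrite -[LHS]/(val _) raddfMn.
have -> : (val z *+ m : cochain _ _) h g = val z h g *+ m.
  have ev : zmod_morphism (fun f : cochain (altfun M n) k.+1 => f h g).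
    by move=> f f'; rewrite cochainB altfunB.
  by have := raddfMn (additive_of ev) m (val z) => /= ->.
rewrite big_const_seq count_predT iter_addr_0.
have [gI|ng] := pselect (injective g); first by rewrite pm.
by rewrite (altcochain_ninj _ _ ng) !mul0rn.
Qed.

(** The [n] entries of [g] themselves serve as apexes. *)
Lemma altcoh_torsion n k (x : Hgrp k.+1 G (altfun M n)) : x *+ n = 0.
Proof.
apply: (@altcoh_cone n n k (fun g => codom g)) => [g _|s g _|g i j _].
- exact: size_codom_ord.
- exact: (map_comp (fun y => s * y)%g g).
- rewrite /codom /image_mem map_comp; apply: perm_map.
  apply: uniq_perm; rewrite ?(map_inj_uniq perm_inj) ?enum_uniq //.
  move=> l; rewrite mem_enum; apply/mapP; exists (tperm i j l); rewrite ?mem_enum //.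
  by rewrite tpermK.
Qed.

End AltCochains.

Definition acyclic (G : groupType) (M : gmodType G) : Prop :=
  forall k (x : Hgrp k.+1 G M), x = 0.

(** * Stabilizers of finite subsets *)

Section Stabilizer.
Variable G : groupType.
Implicit Types (s : G).

Definition stabilizes n (g : 'I_n -> G) s : Prop :=
  forall i, exists j, (s * g i = g j)%g.

Definition free_tuple n (g : 'I_n -> G) : Prop :=
  forall s, stabilizes g s -> s = 1%g.

(** The stabilizer of a subset acts on it by free translations. So all cycles
    of the permutation induced by [s] have the order of [s] as length. *)
Lemma stabilizes_order n (g : 'I_n.+1 -> G) s : injective g -> stabilizes g s ->
  exists m, [/\ (m %| n.+1)%N, has_order s m &
    m = n.+1 -> forall i j, exists k, (g i = s ^+ k * g j)%g].
Proof.
move=> gI gs; have [f fP] := choice gs.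
have fI : injective f.
  by move=> i j e; apply: gI; apply: (@mulgI _ s); rewrite !fP e.
pose p := perm fI.
have pX k i : (s ^+ k * g i = g ((p ^+ k)%g i))%g.
  elim: k => [|k IH]; first by rewrite !expg0 mul1g perm1.
  by rewrite expgS expgSr -mulgA IH fP permM permE.
have p1 k i : ((p ^+ k)%g i = i) <-> (s ^+ k = 1)%g.
  split=> e; last by apply: gI; rewrite -pX e mul1g.
  by apply: (@mulIg _ (g i)); rewrite pX e mul1g.
have psm i : #|porbit p i| = #[p]%g.
  rewrite porbitE card_orbit (_ : 'C_(<[p]>)[i | 'P] = 1)%g ?indexg1 //.
  apply/trivgP/fintype.subsetP => q /setIP[/cycleP[k ->] /astab1P /= e].
  rewrite inE; apply/eqP/permP => j; rewrite perm1.
  by apply/p1/(p1 k i).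
exists #[p]%g; split.
- suff : (#[p]%g %| #|[set: 'I_n.+1]%SET|)%N by rewrite cardsT card_ord.
  rewrite -(acts_sum_card_orbit (to := 'P) (G := <[p]>%g)).
    by apply: dvdn_sum => A /imsetP[i _ ->]; rewrite -porbitE psm.
  by apply/fintype.subsetP => q _; rewrite !inE; apply/fintype.subsetP => x _; rewrite !inE.
- split; first exact: order_gt0.
    by apply/(p1 _ ord0); rewrite expg_order perm1.
  move=> k /andP[k0 km] /(p1 k) e; have : (p ^+ k == 1)%g.
    by apply/eqP/permP => i; rewrite perm1.
  by rewrite -order_dvdn => /dvdn_leq; lia.
move=> m i j; have : i \in porbit p j.
  suff -> : porbit p j = [set: 'I_n.+1]%SET by rewrite inE.
  by apply/eqP; rewrite eqEcard finset.subsetT psm m cardsT card_ord /=.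
by case/porbitP => k ->; exists k; rewrite pX.
Qed.

Section Basepoint.
Variable n : nat.

Let translate s (S : set G) : set G := [set x | S (s^-1 * x)%g].
Let orbit (S : set G) : set (set G) := [set T | exists s, S = translate s T].
Let origin (S : set G) : set G := xget set0 (orbit S).
Let origin_to (S : set G) : G := xget 1%g [set s | S = translate s (origin S)].

(** Fix a representative in each orbit of subsets. If the orbit is free, the
    element that carries the representative to a given subset is unique, hence
    depends equivariantly on the subset. *)
Lemma basepoint_exists : exists b : ('I_n -> G) -> G,
  (forall s g, free_tuple g -> b (fun i => s * g i)%g = (s * b g)%g) /\
  (forall i j g, b (g \o tperm i j) = b g).
Proof.
have trM s t S : translate (s * t)%g S = translate s (translate t S).
  by apply/funext => x; rewrite /translate /= invgM mulgA.
have tr1 S : translate 1%g S = S.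
  by apply/funext => x; rewrite /translate /= invg1 mul1g.
have originP S : S = translate (origin_to S) (origin S).
  have o : orbit S (origin S) by apply: (@xgetPex _ set0 (orbit S)); exists S, 1%g.
  exact: (xgetPex 1%g o).
have origin_tr s S : origin (translate s S) = origin S.
  congr xget; apply/seteqP; split=> T [t e].
    by exists (s^-1 * t)%g; rewrite trM -e -trM mulVg tr1.
  by exists (s * t)%g; rewrite trM -e.
have rangeM s (g : 'I_n -> G) : range (fun i => s * g i)%g = translate s (range g).
  apply/seteqP; split=> [x [i _ <-]|x [i _ e]]; first by exists i; rewrite ?mulKg.
  by exists i; rewrite // e mulVKg.
exists (fun g => origin_to (range g)); split=> [s g gfree|i j g]; last first.
  congr origin_to; apply/seteqP; split=> [x [k _ <-]|x [k _ <-]].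
    by exists (tperm i j k).
  by exists (tperm i j k) => //=; rewrite tpermK.
rewrite rangeM; set S := range g; set t := origin_to S; set t' := origin_to _.
suff /gfree e : stabilizes g (s^-1 * t' * t^-1)%g.
  by rewrite -[t'](mulgVK t) -[(t' / t)%g](mulVKg s) [(s^-1 * _)%g]mulgA e mulg1.
have SE : translate (s^-1 * t' * t^-1)%g S = S.
  have e1 : translate t^-1%g S = origin S.
    by rewrite {1}(originP S) -/t -trM mulVg tr1.
  by rewrite !trM e1 -(origin_tr s S) -originP -trM mulVg tr1.
move=> i; have : S (g i) by exists i.
set u := (_ * _ * _)%g.
have : translate u S (u * g i)%g by rewrite /translate /= mulKg; exists i.
by rewrite SE => -[j _ <-]; exists j.
Qed.

End Basepoint.

(** The equivariant basepoint of a subset serves as single apex. *)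
Lemma alt_acyclic (M : gmodType G) n :
  (forall g : 'I_n -> G, injective g -> free_tuple g) -> acyclic (altfun M n).
Proof.
move=> gfree k x; have [b [bE bS]] := basepoint_exists n.
rewrite -[x]mulr1n; apply: (@altcoh_cone _ _ _ _ _ (fun g => [:: b g])) => //.
- by move=> s g gI; rewrite bE //; apply: gfree.
- by move=> g i j _; rewrite bS.
Qed.

End Stabilizer.

Lemma alt1_acyclic (G : groupType) (M : gmodType G) : acyclic (altfun M 1).
Proof.
apply: alt_acyclic => g gI s /(stabilizes_order gI)[m [m1 [_ e _] _]].
by move: m1 e; rewrite dvdn1 => /eqP ->.
Qed.

Lemma alt_acyclic_torsionfree (G : groupType) (M : gmodType G) n :
  (forall g : G, g <> 1%g -> infinite_order g) -> acyclic (altfun M n.+1).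
Proof.
move=> tf; apply: alt_acyclic => g gI s /(stabilizes_order gI)[m [_ [m0 e _] _]].
by apply: contrapT => /tf /(_ m m0).
Qed.

Lemma alt_acyclic_no_involution (G : groupType) (M : gmodType G) n :
  (forall g : G, ~ has_order g 2) -> (n.+1 %| 4)%N -> acyclic (altfun M n.+1).
Proof.
move=> no2 n4; apply: alt_acyclic => g gI s /(stabilizes_order gI)[m [mn sm _]].
have m4 : (m %| 4)%N := dvdn_trans mn n4.
have m3 : m \in divisors 4 by rewrite -dvdn_divisors.
case: sm; move: m3; rewrite !inE => /or3P[] /eqP-> _ e ne; first by [].
  by case: (no2 s).
(* The remaining divisor is 4, and the square of [s] is an involution. *)
case: (no2 (s ^+ 2)%g); split=> //; first by rewrite -expgnA.
by case=> [|[|k]] // _; rewrite expg1; apply: ne.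
Qed.

(** * Subgroups of given order *)

Lemma subgroup_enum (l : nat) (G : groupType) (C : subgroup_of_order l G) :
  exists (e : 'I_l -> sg_type (sval C)) (r : sg_type (sval C) -> 'I_l),
    cancel e r /\ cancel r e.
Proof.
case: C => C /= /card_set_bijP[f [fC fI fS]].
have fl (c : sg_type C) : (f (val c) < l)%N by apply: fC => /=; apply: (valP c).
pose r c := Ordinal (fl c).
have rI : injective r.
  move=> c d /(congr1 val) /= e; apply: val_inj; apply: fI => //; rewrite inE /=; exact: valP.
have rS i : exists c, r c = i.
  have [x /= xC fx] := fS (val i) (ltn_ord i).
  by exists (Sub x xC); apply: val_inj.
have [e eP] := choice rS.
by exists e, r; split=> // c; apply: rI.
Qed.

Lemma subgroup_order_uniq (l : nat) (G : groupType) (C D : subgroup_of_order l G) :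
  sval C =i sval D -> C = D.
Proof. by case: C D => [C c] [D d] /= /groupClosed_inj e; exact: eq_exist. Qed.

Section CyclicSubgroup.
Variables (G : groupType) (c : G) (l : nat).
Hypothesis cl : has_order c l.

Let powers : {pred G} := fun x => `[< exists k, x = c ^+ k >]%g.

Let powersP x : reflect (exists k, x = c ^+ k)%g (x \in powers).
Proof. exact: asboolP. Qed.

Let powers_mod k : (c ^+ (k %% l) = c ^+ k)%g.
Proof.
by case: cl => _ c1 _; rewrite [in RHS](divn_eq k l) mulnC expgnDr expgnA c1 expg1n mul1g.
Qed.

Fact powers_mul : mulg_closed powers.
Proof.
move=> x y /powersP[i ->] /powersP[j ->]; apply/powersP; exists (i + j)%N.
by rewrite expgnDr.
Qed.
Fact powers_1 : 1%g \in powers.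
Proof. by apply/powersP; exists 0%N. Qed.
Fact powers_inv : invg_closed powers.
Proof.
move=> x /powersP[i ->]; apply/powersP; exists (i * l.-1)%N.
apply: mulg1_eq; case: cl => l0 c1 _; rewrite -expgnDr -mulnS prednK //.
by rewrite mulnC expgnA c1 expg1n.
Qed.
HB.instance Definition _ := isMulClosed.Build G powers powers_mul.
HB.instance Definition _ := isMul1Closed.Build G powers powers_1.
HB.instance Definition _ := isInvClosed.Build G powers powers_inv.

Lemma cyclic_subgroup : exists C : subgroup_of_order l G, forall k, (c ^+ k)%g \in sval C.
Proof.
have cI i j : (i < l)%N -> (j < l)%N -> (c ^+ i = c ^+ j)%g -> i = j.
  case: cl => _ _ ne; wlog ij : i j / (i <= j)%N => [W|] il jl e.
    by have [/W|/ltnW/W] := leqP i j; [apply|move=> h; apply/esym/h].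
  apply: contrapT => nij; apply: (ne (j - i)%N); first by lia.
  by rewrite expgnFr // -e mulgV.
have cardP : ([set` powers] #= `I_l)%card.
  pose f (x : G) := xget 0%N [set k | (k < l)%N /\ x = (c ^+ k)%g].
  have fP x : x \in powers -> (f x < l)%N /\ x = (c ^+ f x)%g.
    move=> /powersP[k xk]; apply: (@xgetPex _ 0%N [set k | (k < l)%N /\ x = (c ^+ k)%g]).
    by exists (k %% l)%N; rewrite /= powers_mod ltn_mod; case: cl.
  apply/card_set_bijP; exists f; split=> [x /= /fP[]//|x y|k /= kl].
    by rewrite !inE => /fP[_ ex] /fP[_ ey] e; rewrite ex ey e.
  exists (c ^+ k)%g; first by apply/powersP; exists k.
  have [|fl e] := fP (c ^+ k)%g; first by apply/powersP; exists k.
  exact/esym/cI.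
by exists (exist _ (powers : groupClosed G) cardP) => k; apply/powersP; exists k.
Qed.

End CyclicSubgroup.

(** * Reduction to subgroups of prime order *)

(** Each [x] is an element of [C] times the chosen representative of its right
    coset. Dividing by the factor that belongs to the identity makes this
    element equal to [x] for [x] in [C]. *)
Lemma retraction_exists (G : groupType) (C : groupClosed G) :
  exists pi : G -> sg_type C,
    (forall c x, pi (val c * x)%g = c * pi x)%g /\ (forall c, pi (val c) = c).
Proof.
pose coset x : set G := [set y | exists c : sg_type C, y = (val c * x)%g]%classic.
pose r x := xget 1%g (coset x).
have rC x : exists c : sg_type C, x = (val c * r x)%g.
  have [c e] : coset x (r x).
    by apply: (@xgetPex _ 1%g (coset x)); exists x, 1%g; rewrite gmulf1 mul1g.
  by exists (c^-1)%g; rewrite gmulfV e mulKg.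
have rM c x : r (val (c : sg_type C) * x)%g = r x.
  congr xget; apply/seteqP; split=> y [d ->].
    by exists (d * c)%g; rewrite gmulfM mulgA.
  by exists (d * c^-1)%g; rewrite gmulfM gmulfV -mulgA mulKg.
have [p pP] := choice rC.
have pM c x : p (val c * x)%g = (c * p x)%g.
  apply: val_inj; apply: (@mulIg _ (r x)).
  by rewrite -[X in (_ * X)%g](rM c) -pP gmulfM -mulgA -pP.
exists (fun x => p x * (p 1)^-1)%g; split=> [c x|c]; first by rewrite pM mulgA.
by rewrite -[val c]mulg1 pM mulgK.
Qed.

Section Restrict.
Variables (G : groupType) (M : gmodType G) (C : groupClosed G) (n : nat).
Let MC : gmodType (sg_type C) := resmod C M.

Section Deg.
Variables (k : nat) (f : cochain (altfun M n) k).

Let F (h : 'I_k.+1 -> sg_type C) (g : 'I_n -> sg_type C) : MC :=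
  f (val \o h) (val \o g).

Fact restrict_alternates h : alternates (F h).
Proof.
move=> i j ij; have [f0 fN] := altfun_alternates (f (val \o h)) ij.
by split=> g; [move=> e; apply: f0; rewrite /= e|exact: (fN (val \o g))].
Qed.

Fact restrict_equivariant s h g :
  F (fun i => s * h i)%g (fun i => s * g i)%g = gact s (F h g).
Proof.
rewrite [RHS](esym (altcochain_equivariant f (val s) (val \o h) (val \o g))).
by congr (altfun_val (cochain_fun f _) _); apply/funext => i /=; rewrite gmulfM.
Qed.

Definition restrict : cochain (altfun MC n) k :=
  altcochain restrict_alternates restrict_equivariant.

Lemma restrictE h g : restrict h g = f (val \o h) (val \o g). Proof. by []. Qed.
End Deg.

Fact restrict_zmod_morphism k : zmod_morphism (@restrict k).
Proof.
move=> f f'; apply: cochain_ext => h; apply: altfun_ext => g.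
by rewrite cochainB altfunB !restrictE cochainB altfunB.
Qed.

Fact restrict_comm k (f : cochain (altfun M n) k) :
  cochain_diff (restrict f) = restrict (cochain_diff f).
Proof.
apply: cochain_ext => h; apply: altfun_ext => g.
by rewrite altcochain_diffE restrictE altcochain_diffE.
Qed.

Definition restrict_map :
    chain_map (group_complex (altfun M n)) (group_complex (altfun MC n)) :=
  @ChainMap (group_complex (altfun M n)) (group_complex (altfun MC n))
    (fun k => additive_of (@restrict_zmod_morphism k)) restrict_comm.

End Restrict.
Arguments restrict {G M} C {n k} f.
Arguments restrict_map {G} M C n.

Lemma gact_resmod (G : groupType) (M : gmodType G) (C : groupClosed G)
    (c : sg_type C) (x : resmod C M) : gact c x = gact (val c) (x : M).
Proof. by []. Qed.

Section PrimeTuples.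
Variables (G : groupType) (p : nat).
Implicit Types (g : 'I_p.+1 -> G) (C : subgroup_of_order p.+1 G).

(** The entries of [g] are the points of the left coset of [C] at its first
    entry; it will turn out that all non-free subsets of prime size are such
    cosets. *)
Definition spans C g : Prop :=
  injective g /\ forall i, exists c : sg_type (sval C), (g i = g ord0 * val c)%g.

Lemma spansP C g : spans C g -> forall x, x \in sval C <-> exists i, (x = (g ord0)^-1 * g i)%g.
Proof.
move=> [gI gC] x; split=> [xC|[i ->]]; last first.
  by have [c ->] := gC i; rewrite mulKg; apply: (valP c).
have [e [r [eK rK]]] := subgroup_enum C; have [f fP] := choice gC.
have fI : injective (fun i => r (f i)).
  by move=> i j /(can_inj rK) fij; apply: gI; rewrite (fP i) (fP j) fij.
have /codomP[i ei] := injF_onto fI (r (Sub x xC)).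
by exists i; rewrite (fP i) mulKg -[f i]rK -ei rK.
Qed.

Lemma spans_uniq C D g : spans C g -> spans D g -> C = D.
Proof.
move=> Cg Dg; apply: subgroup_order_uniq => x.
by apply/idP/idP => [/(spansP Cg)/(spansP Dg)|/(spansP Dg)/(spansP Cg)].
Qed.

Lemma spans_mul C s g : spans C (fun i => s * g i)%g <-> spans C g.
Proof.
split=> -[/inj_mulg gI gC]; split=> // i; have [c e] := gC i; exists c.
  by apply: (@mulgI _ s); rewrite mulgA.
by rewrite e mulgA.
Qed.

Lemma spans_tperm C i j g : spans C g -> spans C (g \o tperm i j).
Proof.
move=> [gI gC]; split=> [|k /=]; first exact: inj_comp gI (@perm_inj _ _).
have [c ->] := gC (tperm i j k); have [d ->] := gC (tperm i j ord0).
exists (d^-1 * c)%g.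
have E : (val (d^-1 * c)%g = (val d)^-1 * val c)%g by rewrite gmulfM gmulfV.
by rewrite [X in _ = (_ * X)%g]E !mulgA mulgK.
Qed.

(** A nontrivial element [s] of the stabilizer must have order [p.+1], so that
    the subset is a single orbit of the powers of [s]. Seen from its first
    entry it is a left coset of the group generated by a conjugate of [s]. *)
Lemma free_or_spans g : prime p.+1 -> injective g ->
  ~ (exists C, spans C g) -> free_tuple g.
Proof.
move=> pP gI ng s sg; have [m [mp sm sT]] := stabilizes_order gI sg.
have /primeP[_ /(_ m mp)] := pP; case/orP=> /eqP em.
  by case: sm => _; rewrite em.
case: ng; pose c := (s ^ g ord0)%g.
have cX k : (c ^+ k = (s ^+ k) ^ g ord0)%g by rewrite conjXg.
have cl : has_order c p.+1.
  rewrite -em; case: sm => m0 s1 ne; split=> //; first by rewrite cX s1 conj1g.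
  by move=> k km; rewrite cX => /eqP; rewrite conjg_eq1 => /eqP; apply: ne.
have [C CP] := cyclic_subgroup cl; exists C; split=> // i.
have [k e] := sT em i ord0; exists (Sub (c ^+ k)%g (CP k)).
by rewrite SubK cX e conjgE mulVKg.
Qed.

Definition retr C := sval (cid (retraction_exists (sval C))).
Lemma retrM C c x : retr C (val c * x)%g = (c * retr C x)%g.
Proof. by rewrite /retr; case: cid => q /= []. Qed.
Lemma retrV C c : retr C (val c) = c.
Proof. by rewrite /retr; case: cid => q /= []. Qed.

Lemma prism_gact (M : gmodType G) k s (P P' : G -> G) (f f' : ('I_k.+1 -> G) -> M) h :
  (forall x : G, P' (s * x) = s * P x)%g ->
  (forall u, f' (fun i => s * u i)%g = gact s (f u)) ->
  prism P' f' (fun i => s * h i)%g = gact s (prism P f h).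
Proof.
move=> PP'; elim: k f f' h => [|k IH] f f' h ff'; first by rewrite /= gact0.
rewrite /= gactB -ff' tcons_mul PP'; congr (f' _ - _).
by apply: (IH _ _ (h \o lift ord0)) => u; rewrite -ff' tcons_mul.
Qed.

Variables (M : gmodType G).
Hypothesis pP : prime p.+1.

Let MC C : gmodType (sg_type (sval C)) := resmod (sval C) M.
Let family k := forall C, cochain (altfun (MC C) p.+1) k.

Section Spread.
Variables (k : nat) (phi : family k).

(** Translate the coset back to [C] and retract the group variables to [C].
    Equivariance of [phi C] makes the value independent of the point of the
    coset that comes first. *)
Definition spread_on C (h : 'I_k.+1 -> G) g : M :=
  gact (g ord0) (phi C (fun i => retr C ((g ord0)^-1 * h i)%g)
                       (fun i => retr C ((g ord0)^-1 * g i)%g) : M).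

Definition spread_fun h g : M :=
  match pselect (exists C, spans C g) with
  | left e => spread_on (sval (cid e)) h g
  | right _ => 0
  end.

Lemma spread_funE C h g : spans C g -> spread_fun h g = spread_on C h g.
Proof.
move=> Cg; rewrite /spread_fun; case: pselect => [e|[]]; last by exists C.
by rewrite (spans_uniq (svalP (cid e)) Cg).
Qed.

Lemma spread_fun0 h g : ~ (exists C, spans C g) -> spread_fun h g = 0.
Proof. by rewrite /spread_fun; case: pselect. Qed.

Fact spread_alternates h : alternates (spread_fun h).
Proof.
apply: alternates_inj => [g ng|i j g ij gI].
  by apply: spread_fun0 => -[C [gI _]].
have [[C Cg]|nC] := pselect (exists C, spans C g); last first.
  rewrite !spread_fun0 ?oppr0 // => -[C /(spans_tperm i j) Cg]; apply: nC; exists C.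
  by rewrite (_ : g = (g \o tperm i j) \o tperm i j) //; apply/funext => x /=; rewrite tpermK.
rewrite (spread_funE h Cg) (spread_funE h (spans_tperm i j Cg)) /spread_on.
have [gI' gC] := Cg; have [c e] := gC (tperm i j ord0).
have E x : retr C (((g \o tperm i j) ord0)^-1 * x)%g = (c^-1 * retr C ((g ord0)^-1 * x))%g.
  by rewrite /= e invgM -retrM gmulfV mulgA.
set H := fun k => retr C ((g ord0)^-1 * h k)%g.
set Q := fun k => retr C ((g ord0)^-1 * g k)%g.
have -> : phi C (fun k => retr C (((g \o tperm i j) ord0)^-1 * h k)%g)
    (fun k => retr C (((g \o tperm i j) ord0)^-1 * (g \o tperm i j) k)%g) =
    gact c^-1%g (- phi C H Q : MC C).
  rewrite -(altfun_alternates (phi C H) ij).2 -altcochain_equivariant.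
  by congr (altfun_val (cochain_fun _ _) _); apply/funext => l; rewrite E.
have e' : (g \o tperm i j) ord0 = (g ord0 * val c)%g := e.
rewrite gact_resmod -gactM e' gmulfV mulgK; exact: gactN.
Qed.

Fact spread_equivariant s h g :
  spread_fun (fun i => s * h i)%g (fun i => s * g i)%g = gact s (spread_fun h g).
Proof.
have [[C Cg]|nC] := pselect (exists C, spans C g); last first.
  by rewrite !spread_fun0 ?gact0 // => -[C /spans_mul Cg]; apply: nC; exists C.
have /spans_mul Csg := Cg.
rewrite (spread_funE h Cg) (@spread_funE C); last by apply/spans_mul.
have E k' (u : 'I_k' -> G) : (fun i => retr C ((s * g ord0)^-1 * (s * u i))%g) =
    (fun i => retr C ((g ord0)^-1 * u i)%g).
  by apply/funext => i; rewrite invgM -mulgA mulKg.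
by rewrite /spread_on !E gactM.
Qed.

Definition spread : cochain (altfun M p.+1) k :=
  altcochain spread_alternates spread_equivariant.

Lemma spreadE C h g : spans C g -> spread h g = spread_on C h g.
Proof. exact: spread_funE. Qed.

Lemma spread0 h g : ~ (exists C, spans C g) -> spread h g = 0.
Proof. exact: spread_fun0. Qed.

Lemma restrict_spread C : restrict (sval C) spread = phi C.
Proof.
apply: cochain_ext => h; apply: altfun_ext => g; rewrite restrictE.
have [gI|ng] := pselect (injective g); last first.
  rewrite [RHS]altcochain_ninj //; apply: (@altcochain_ninj G M _ _ spread) => gI; apply: ng.
  by move=> i j e; apply: gI; rewrite /= e.
have Cg : spans C (val \o g).
  split; first exact: inj_comp val_inj gI.
  by move=> i; exists ((g ord0)^-1 * g i)%g; rewrite gmulfM gmulfV mulVKg.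
have E x : retr C ((val (g ord0))^-1 * val x)%g = ((g ord0)^-1 * x)%g.
  by rewrite -gmulfV retrM retrV.
rewrite (spreadE _ Cg) /spread_on.
have -> : (fun i => retr C (((val \o g) ord0)^-1 * (val \o h) i)%g) =
    (fun i => (g ord0)^-1 * h i)%g by apply/funext => i; exact: E.
have -> : (fun i => retr C (((val \o g) ord0)^-1 * (val \o g) i)%g) =
    (fun i => (g ord0)^-1 * g i)%g by apply/funext => i; exact: E.
rewrite altcochain_equivariant gact_resmod -gactM -gmulfM mulgV.
by rewrite gmulf1 gact1.
Qed.

End Spread.

Lemma spread_diff k (phi : family k) :
  cochain_diff (spread phi) = spread (fun C => cochain_diff (phi C)).
Proof.
apply: cochain_ext => h; apply: altfun_ext => g; rewrite altcochain_diffE.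
have [[C Cg]|nC] := pselect (exists C, spans C g); last first.
  rewrite spread0 // /cof big1 // => j _.
  by rewrite spread0 ?mul0rz.
rewrite (spreadE _ _ Cg) /spread_on altcochain_diffE.
set Q := fun i => retr C _; set H := fun i => retr C _.
apply: (etrans _ (esym (gact_cof (fun v => phi C v Q : M) (g ord0) H))).
by apply: eq_bigr => j _; rewrite (spreadE _ _ Cg).
Qed.

(** Over a coset [g ord0 * C], the prism of the retraction of [G] to that coset
    is a homotopy from the cocycle to its values at group variables in the
    coset, and these are translates of values on [C]. Over a free orbit, the
    cone at an equivariant basepoint is a contraction. *)
Lemma restrict0_coboundary k (z : cocycle (group_complex (altfun M p.+1)) k.+1) :
  (forall C, restrict (sval C) (val z) = 0) -> is_coboundary (val z).
Proof.
move=> z0; have [b [bE bS]] := basepoint_exists G p.+1.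
pose P C g (x : G) : G := (g ord0 * val (retr C ((g ord0)^-1 * x)))%g.
pose D h g : M := match pselect (exists C, spans C g) with
  | left e => prism (P (sval (cid e)) g) (fun u => val z u g) h
  | right _ => val z (tcons (b g) h) g
  end.
have DE C h g : spans C g -> D h g = prism (P C g) (fun u => val z u g) h.
  move=> Cg; rewrite /D; case: pselect => [e|[]]; last by exists C.
  by rewrite (spans_uniq (svalP (cid e)) Cg).
have D0 h g : ~ (exists C, spans C g) -> D h g = val z (tcons (b g) h) g.
  by rewrite /D; case: pselect.
have PT C g i j x : spans C g -> P C (g \o tperm i j) x = P C g x.
  move=> [gI gC]; have [c e] := gC (tperm i j ord0).
  have e' : (g \o tperm i j) ord0 = (g ord0 * val c)%g := e.
  have E : ((g ord0 * val c)^-1 * x = val (c^-1) * ((g ord0)^-1 * x))%g.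
    by rewrite invgM gmulfV mulgA.
  by rewrite /P e' E retrM gmulfM gmulfV mulgA mulgK.
have DA h : alternates (D h).
  apply: alternates_inj => [g ng|i j g ij gI].
    by rewrite D0 ?altcochain_ninj // => -[C []].
  have [[C Cg]|nC] := pselect (exists C, spans C g).
    rewrite (DE _ _ _ Cg) (DE _ _ _ (spans_tperm i j Cg)).
    rewrite (_ : P C (g \o tperm i j) = P C g); last by apply/funext => x; exact: PT.
    rewrite -[RHS]sub0r -(prism0 M (P C g) h) -prismB; congr (prism _ _ _).
    by apply/funext => u; rewrite (altfun_alternates _ ij).2 sub0r.
  rewrite (D0 _ _ nC) D0 ?bS ?(altfun_alternates _ ij).2 // => -[C /(spans_tperm i j) Cg].
  apply: nC; exists C; rewrite (_ : g = (g \o tperm i j) \o tperm i j) //.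
  by apply/funext => x /=; rewrite tpermK.
have DT s h g : D (fun i => s * h i)%g (fun i => s * g i)%g = gact s (D h g).
  have [[C Cg]|nC] := pselect (exists C, spans C g).
    rewrite (DE _ _ _ Cg) (DE C); last by apply/spans_mul.
    apply: prism_gact => [x|u]; last exact: altcochain_equivariant.
    by rewrite /P invgM -[((_ * s^-1) * _)%g]mulgA mulKg mulgA.
  have nC' : ~ (exists C, spans C (fun i => s * g i)%g).
    by move=> [C /spans_mul Cg]; apply: nC; exists C.
  rewrite !D0 //; have [gI|ng] := pselect (injective g); last first.
    by rewrite !altcochain_ninj ?gact0 // => /inj_mulg.
  by rewrite bE -?tcons_mul ?altcochain_equivariant //; apply: free_or_spans.
exists (altcochain DA DT); apply: cochain_ext => h; apply: altfun_ext => g.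
rewrite [LHS]altcochain_diffE /=.
have [[C Cg]|nC] := pselect (exists C, spans C g); last first.
  rewrite -[RHS](altcocycle_cone z (b g)); congr cof.
  by apply/funext => u; rewrite D0.
have -> : (fun u => D u g) = prism (P C g) (fun u => val z u g).
  by apply/funext => u; rewrite (DE C).
have := prism_homotopy (P C g) (fun u => val z u g) h.
have -> : cof (fun u => val z u g) = fun _ => 0.
  by apply/funext => u; rewrite altcocycle_cof.
rewrite prism0 addr0 => ->.
suff -> : val z (P C g \o h) g = 0 by rewrite subr0.
pose Q k' (u : 'I_k' -> G) i := retr C ((g ord0)^-1 * u i)%g.
have := congr1 (fun f : cochain (altfun (MC C) p.+1) _ => f (Q _ h) (Q _ g)) (z0 C).
rewrite cochain0 altfun0 restrictE => /(congr1 (gact (g ord0) : M -> M)).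
rewrite (gact0 M) -altcochain_equivariant => <-.
congr (altfun_val (cochain_fun _ _) _); apply/funext => i; rewrite //=.
have [gI gC] := Cg; have [c e] := gC i.
by rewrite /Q e mulKg retrV.
Qed.

(** The argument of Shapiro's lemma, applied to each orbit of subsets: free
    orbits contribute nothing in positive degrees, and any other orbit contains
    exactly one subgroup of order [p.+1]. Hence the product is over subgroups
    and not over their conjugacy classes. *)
Theorem alt_prime_subgroups k :
  iso (Hgrp k.+1 G (altfun M p.+1))
      (dprod (fun C : subgroup_of_order p.+1 G =>
         Hgrp k.+1 (sg_type (sval C)) (altfun (MC C) p.+1))).
Proof.
pose T C := Hgrp k.+1 (sg_type (sval C)) (altfun (MC C) p.+1).
pose R (x : Hgrp k.+1 G (altfun M p.+1)) : dprod T :=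
  fun C => cohomology_hom (restrict_map M (sval C) p.+1) k.+1 x.
have RB : zmod_morphism R.
  by move=> x y; apply: functional_extensionality_dep => C; rewrite /R raddfB.
exists (additive_of RB); apply: inj_surj_bij.
  apply: additive_inj => x; have [z <-] := cls_surj x => /= Rz.
  have yP C : exists y : cochain (altfun (MC C) p.+1) k,
      cochain_diff y = restrict (sval C) (val z).
    have := congr1 (fun t : dprod T => t C) Rz.
    by rewrite /R [cohomology_hom _ _ _]cohomology_map_cls => /cls_eq0[y e]; exists y.
  pose y C := sval (cid (yP C)).
  have dz' : cc_diff (group_complex (altfun M p.+1)) k.+1
      (val z - cochain_diff (spread y)) = 0.
    by rewrite raddfB cocycle_diff [X in _ - X]cochain_diffK subrr.
  have [C|w /= wz] := @restrict0_coboundary k (mkcocycle dz').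
    rewrite [LHS](raddfB (restrict_map M (sval C) p.+1 k.+1)) /=.
    by rewrite -restrict_comm restrict_spread (svalP (cid (yP C))) subrr.
  apply/cls_eq0; exists (w + spread y).
  by rewrite raddfD /= wz subrK.
move=> t; pose w C := sval (cid (cls_surj (t C))).
have ds : cc_diff (group_complex (altfun M p.+1)) k.+1
    (spread (fun C => val (w C))) = 0.
  rewrite /= spread_diff; apply: cochain_ext => h; apply: altfun_ext => g.
  rewrite cochain0 altfun0; have [[C Cg]|nC] := pselect (exists C, spans C g).
    rewrite (spreadE _ _ Cg) /spread_on.
    by rewrite [cochain_diff _](cocycle_diff (w C)) cochain0 altfun0; apply: gact0.
  by rewrite spread0.
exists (cls (mkcocycle ds)); apply: functional_extensionality_dep => C.
rewrite /= /R [LHS]cohomology_map_cls -[RHS](svalP (cid (cls_surj (t C)))).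
by congr cls; apply: val_inj; rewrite /= restrict_spread.
Qed.

End PrimeTuples.

(** * Comparison with exterior cohomology *)

Section Invariants.
Variables (G : groupType) (N : gmodType G).

Lemma cochain0_diff (w : cochain N 0) h :
  cochain_diff w h = w (h \o lift ord0) - w (h \o lift ord_max).
Proof.
rewrite /= /coface_sum big_ord_recl big_ord1 expr0 expr1 mulrNz.
by congr (_ - w _); apply/funext => i /=; congr h; apply: val_inj.
Qed.

Lemma cocycle0_const (w : cocycle (group_complex N) 0) h h' : val w h = val w h'.
Proof.
pose t : 'I_2 -> G := tcons (h' ord0) h.
have := cochain0_diff (val w) t; rewrite [cochain_diff _](cocycle_diff w) cochain0.
rewrite tcons_lift0 => /esym/eqP; rewrite subr_eq0 => /eqP ->; congr (cochain_fun _ _).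
apply/funext => i; rewrite ord1 /= (_ : lift ord_max ord0 = ord0).
  by rewrite /t tcons0.
exact: val_inj.
Qed.

Lemma cocycle0_invariant (w : cocycle (group_complex N) 0) h s :
  gact s (val w h) = val w h.
Proof. by rewrite -cochain_equivariant; apply: cocycle0_const. Qed.

Lemma cls0_inj (w w' : cocycle (group_complex N) 0) : cls w = cls w' -> w = w'.
Proof. by move=> /cls_eq /= /subr0_eq e; apply: val_inj. Qed.

Variables (x : N) (xG : forall s, gact s x = x).

Definition const_cochain : cochain N 0 :=
  mkcochain (f := fun _ => x) (fun s _ => esym (xG s)).

Fact const_cochain_diff : cc_diff (group_complex N) 0 const_cochain = 0.
Proof. by apply: cochain_ext => h; rewrite [LHS]cochain0_diff subrr cochain0. Qed.

Definition const_cocycle : cocycle (group_complex N) 0 := mkcocycle const_cochain_diff.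

End Invariants.

Section Comparison.
Variables (G : groupType) (M : gmodType G).

Lemma ext_alternates n (y : ext_cochain M n) : alternates (ext_cochain_val y).
Proof. by apply: adjacent_alternates; have /asboolP := ext_cochainP y. Qed.

Definition ext_altfun n (y : ext_cochain M n) : altfun M n.+1 :=
  mkaltfun (ext_alternates y).

Lemma ext_altfun_invariant n (y : ext_cochain M n) s : gact s (ext_altfun y) = ext_altfun y.
Proof.
apply: altfun_ext => g; rewrite alt_gactE /= -cochain_equivariant.
by congr (cochain_fun _ _); apply/funext => i; rewrite mulVKg.
Qed.

Section OfAltfun.
Variables (n : nat) (a : altfun M n.+1) (aG : forall s, gact s a = a).

Fact altfun_equivariant s (g : 'I_n.+1 -> G) : a (fun i => s * g i)%g = gact s (a g).
Proof. by rewrite -{1}(aG s) alt_gact_mul. Qed.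

Fact altfun_alternating : mkcochain altfun_equivariant \in @alternating G M n.
Proof.
apply/asboolP => i; have ij : pos i != succ_pos i by rewrite -val_eqE /= /bump; lia.
have [a0 aN] := altfun_alternates a ij; split=> // g.
by rewrite /= aN opprK.
Qed.

Definition altfun_ext_cochain : ext_cochain M n := ExtCochain altfun_alternating.
End OfAltfun.

Lemma ext_cochain_ext n (y y' : ext_cochain M n) : (forall g, y g = y' g) -> y = y'.
Proof. by move=> e; apply: val_inj; apply: cochain_ext. Qed.

Lemma ext_cof n (z : cocycle (ext_complex M) n) t : cof (val z) t = 0.
Proof.
have := congr1 (fun y : ext_cochain M n.+1 => y t) (cocycle_diff z).
have v0 := raddf0 (val : ext_cochain M n.+1 -> cochain M n.+1).
move=> e; apply: etrans e (etrans (congr1 (fun c : cochain _ _ => c t) v0) _).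
exact: cochain0.
Qed.

Lemma tup_cat_l m j (h : 'I_m -> G) (g : 'I_j -> G) a :
  tup 1%g (m + j) (codom h ++ codom g) (lshift j a) = h a.
Proof.
rewrite /tup nth_cat size_codom_ord /= ltn_ord.
by rewrite -[LHS]/(tup 1%g m (codom h) a) codomK.
Qed.

Lemma tup_cat_r m j (h : 'I_m -> G) (g : 'I_j -> G) b :
  tup 1%g (m + j) (codom h ++ codom g) (rshift m b) = g b.
Proof.
rewrite /tup nth_cat size_codom_ord /= ltnNge leq_addr /= addKn.
by rewrite -[LHS]/(tup 1%g j (codom g) b) codomK.
Qed.

Section Curry.
Variables (n k j : nat) (e : n = (k + j)%N) (f : ext_cochain M n).

(** The first [k.+1] variables of [f] become those of a group cochain, the other
    [j] those of its values. The degree [n] is tied to [k] and [j] by an equation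
    only, because the same [f] is read with [k + j.+1] and with [k.+1 + j]. *)
Definition curry_fun (h : 'I_k.+1 -> G) (g : 'I_j -> G) : M :=
  f (tup 1%g n.+1 (codom h ++ codom g)).

Fact curry_alternates h : alternates (curry_fun h).
Proof.
rewrite /curry_fun; move: f; rewrite e => y i i' ii'.
have L (g : 'I_j -> G) (a : 'I_k.+1) :
    tup 1%g (k + j).+1 (codom h ++ codom g) (lshift j a) = h a.
  exact: tup_cat_l.
have R (g : 'I_j -> G) (b : 'I_j) :
    tup 1%g (k + j).+1 (codom h ++ codom g) (rshift k.+1 b) = g b.
  exact: tup_cat_r.
have [|y0 yN] := @ext_alternates _ y (rshift k.+1 i) (rshift k.+1 i').
  by rewrite -val_eqE /= eqn_add2l.
split=> g; first by move=> gi; apply: y0; rewrite !R.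
rewrite -yN; congr (cochain_fun _ _); apply/funext => x.
case: (@split_ordP k.+1 j x) => [a ->|b ->]; rewrite [RHS]/=.
  by rewrite tpermD ?L // -val_eqE /=; have := ltn_ord a; lia.
have <- : rshift k.+1 (tperm i i' b) = tperm (rshift k.+1 i) (rshift k.+1 i') (rshift k.+1 b).
  exact: inj_tperm (@rshift_inj _ _).
by rewrite !R.
Qed.

Fact curry_equivariant s h g :
  curry_fun (fun i => s * h i)%g (fun i => s * g i)%g = gact s (curry_fun h g).
Proof.
rewrite /curry_fun -cochain_equivariant; congr (cochain_fun _ _).
move: f; rewrite e => _; apply/funext => x.
case: (@split_ordP k.+1 j x) => [a ->|b ->].
  by rewrite [LHS](tup_cat_l (m := k.+1)) [X in _ = (_ * X)%g](tup_cat_l (m := k.+1)).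
by rewrite [LHS](tup_cat_r (m := k.+1)) [X in _ = (_ * X)%g](tup_cat_r (m := k.+1)).
Qed.

Definition curry : cochain (altfun M j) k :=
  altcochain curry_alternates curry_equivariant.

Lemma curryE h g : curry h g = f (tup 1%g n.+1 (codom h ++ codom g)).
Proof. by []. Qed.
End Curry.

(** The coboundary of an exterior cocycle is zero; the faces that omit one of
    the first [k.+2] variables and those that omit one of the last [j.+1] are
    the two sides. *)
Lemma curry_diff n k j (e : n = (k + j.+1)%N) (e' : n = (k.+1 + j)%N)
    (z : cocycle (ext_complex M) n) :
  cochain_diff (curry e (val z)) =
  cochain_map (Altz_incl M j.+1) (cochain_map (Altq M j) (curry e' (val z))) *~ (-1) ^+ k.+1.
Proof.
apply: cochain_ext => h; apply: altfun_ext => g; rewrite altcochain_diffE.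
have ev : zmod_morphism (fun c : cochain (altfun M j.+1) k.+1 => c h g).
  by move=> c c'; rewrite cochainB altfunB.
rewrite [RHS](raddfMz (additive_of ev)) /=.
have sz : size (codom h ++ codom g) = n.+2 by rewrite size_cat !size_codom_ord; lia.
have := ext_cof z (tup 1%g n.+2 (codom h ++ codom g)).
rewrite (cof_scof 1%g) tupK // scof_cat size_codom_ord => /eqP.
rewrite addr_eq0 -mulrNz => /eqP; rewrite exprS mulN1r opprK => E.
rewrite (cof_scof 1%g) (cof_scof 1%g).
rewrite (eq_scof (n := k.+1) (f' := fun u => val z (tup 1%g n.+1 (u ++ codom g))))
  ?size_codom_ord //; last first.
  by move=> u su; rewrite /= /curry_fun tupK.
rewrite E; congr (_ *~ _).
apply: (eq_scof (n := j)) => [u su|]; last by rewrite size_codom_ord.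
by rewrite /= /curry_fun tupK.
Qed.

Lemma curry_degree0 n (e : n = (n + 0)%N) (f : ext_cochain M n) h g :
  curry e f h g = f h.
Proof.
rewrite curryE (_ : codom g = [::]) ?cats0 ?codomK //.
by apply: size0nil; rewrite size_codom_ord.
Qed.

Fact curry_cocycle n k j (e : n = (k + j)%N) (z : cocycle (ext_complex M) n) :
  cc_diff (group_complex (Altz M j.+1)) k (cochain_map (Altq M j) (curry e (val z))) = 0.
Proof.
rewrite /= cochain_map_comm; case: j e => [|j] e.
  have e' : k = n by rewrite e addn0.
  subst k.
  have -> : cochain_diff (curry e (val z)) = 0.
    apply: cochain_ext => h; apply: altfun_ext => g.
    rewrite altcochain_diffE cochain0 altfun0 -[RHS](ext_cof z h); congr cof.
    by apply/funext => u; exact: curry_degree0.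
  exact: (raddf0 (complex_map (Altq M 0) n.+1)).
have e' : n = (k.+1 + j)%N by lia.
rewrite (curry_diff e e') [LHS](raddfMz (complex_map (Altq M j.+1) k.+1)).
rewrite [X in X *~ _](_ : _ = 0) ?mul0rz //.
apply/(@cochain_map_exact _ _ _ _ _ _ (@gker_incl_inj _ _ _ _) (@Alt_exact G M j.+1) k.+1).
by eexists.
Qed.

(** These classes interpolate between the exterior cocycle itself, an invariant
    for [k = 0], and its image in the cohomology of [M], for [j = 0]. *)
Definition curry_class n k j (e : n = (k + j)%N) (z : cocycle (ext_complex M) n) :
    Hgrp k G (Altz M j.+1) :=
  cls (mkcocycle (curry_cocycle e z)).

Lemma curry_classB n k j (e : n = (k + j)%N) (z z' : cocycle (ext_complex M) n) :
  curry_class e (z - z') = curry_class e z - curry_class e z'.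
Proof.
rewrite /curry_class -clsB; congr cls; apply: val_inj => /=.
rewrite -[RHS](raddfB (complex_map (Altq M j) k)) /=; congr cochain_map.
apply: cochain_ext => h; apply: altfun_ext => g.
rewrite cochainB altfunB !curryE.
have vB := raddfB (val : ext_cochain M n -> cochain M n) (val z) (val z').
by apply: etrans (congr1 (fun c : cochain M n => c _) vB) _; apply: cochainB.
Qed.

(** The cochain [curry e z] lifts the class explicitly, and [curry_diff] computes
    its coboundary. The sign in that formula is absorbed in [delta]. *)
Lemma curry_class_conn j k : exists delta :
    {additive Hgrp k G (Altz M j.+2) -> Hgrp k.+1 G (Altz M j.+1)},
  [/\ exact_at (Hmap (Altq M j.+1) k) delta,
      exact_at delta (Hmap (Altz_incl M j.+1) k.+1) &
      forall n (e : n = (k + j.+1)%N) (e' : n = (k.+1 + j)%N) z,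
        delta (curry_class e z) = curry_class e' z].
Proof.
pose s : int := (-1) ^+ k.+1.
have ss : s * s = 1 by rewrite /s -exprD addnn -signr_odd odd_double.
have dB : zmod_morphism (fun x => Altconn M j.+1 k x *~ s).
  by move=> x y; rewrite raddfB mulrzBl.
have s0 (A : zmodType) (x : A) : x *~ s = 0 <-> x = 0.
  by split=> [e|->]; rewrite ?mul0rz // -[x]mulr1z -ss mulrzA e mul0rz.
exists (additive_of dB); split.
- by move=> y; rewrite /= s0; apply: Alt_les_right.
- move=> y; rewrite (Alt_les_left y).
  split=> -[x <-]; exists (x *~ s); last by rewrite raddfMz.
  by rewrite /= raddfMz -mulrzA ss.
- move=> n e e' z /=.
  have E : Altconn M j.+1 k (curry_class e z) = cls (mkcocycle (curry_cocycle e' z) *~ s).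
    apply: HconnE (curry e (val z)) _ _ _ _; first by [].
    rewrite (curry_diff e e') [val _](raddfMz (val : cocycle _ _ -> _)).
    by rewrite [LHS](raddfMz (complex_map (Altz_incl M j.+1) k.+1)).
  rewrite E [cls _](raddfMz (\pi_(cohomology (group_complex (Altz M j.+1)) k.+1)%qT)).
  by rewrite -mulrzA ss.
Qed.

End Comparison.

(** * Dimension shifting *)

Section Shift.
Variables (G : groupType) (M : gmodType G).

Fact const_alternates (x : M) : alternates (fun _ : 'I_0 -> G => x).
Proof. by case. Qed.

Definition const_altz (x : M) : Altz M 1 := Altq M 0 (mkaltfun (const_alternates x)).

Lemma const_altzE x (g : 'I_1 -> G) : gker_val (const_altz x) g = x.
Proof. by rewrite /= (cof_nullary _ _ (g \o lift ord0)). Qed.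

Lemma altz_ext n (a b : Altz M n) : (forall g, gker_val a g = gker_val b g) -> a = b.
Proof. by move=> e; apply: val_inj; apply: altfun_ext. Qed.

Fact const_altz_zmod_morphism : zmod_morphism const_altz.
Proof.
move=> x y; apply: altz_ext => g.
have := raddfB (gker_incl (Altd M 1)) (const_altz x) (const_altz y).
move/(congr1 (fun a : altfun M 1 => a g)); rewrite altfunB => e.
rewrite const_altzE; apply/esym/(etrans e).
by rewrite -[LHS]/(gker_val (const_altz x) g - gker_val (const_altz y) g) !const_altzE.
Qed.

Fact const_altz_act s x : const_altz (gact s x) = gact s (const_altz x).
Proof.
apply: altz_ext => g; rewrite [RHS]alt_gactE.
by rewrite -[gker_val (const_altz x)]/(gker_val (const_altz x)) !const_altzE.
Qed.

Definition augmentation : gmap M (Altz M 1) :=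
  mkgmap const_altz_zmod_morphism const_altz_act.

Lemma augmentation_bij : bijective augmentation.
Proof.
apply: inj_surj_bij => [x y /(congr1 (fun a : Altz M 1 => gker_val a (fun _ => 1%g)))|z].
  by rewrite !const_altzE.
have [a <-] := Altq_surj z; exists (a (fun _ => 1%g)).
apply: altz_ext => g; rewrite const_altzE /= (cof_nullary _ _ (g \o lift ord0)).
by congr (altfun_val a _); apply/funext; case.
Qed.

Lemma curry_class_base n (e : n = (n + 0)%N) (z : cocycle (ext_complex M) n) :
  curry_class e z = Hmap augmentation n (beta n G M (cls z)).
Proof.
rewrite [beta n G M _]cohomology_map_cls [RHS]cohomology_map_cls; congr cls.
apply: val_inj; apply: cochain_ext => h; apply: altz_ext => g.
rewrite const_altzE /= (cof_nullary _ _ (g \o lift ord0)).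
exact: curry_degree0.
Qed.

(** Composing connecting maps; each is bijective because the cohomology of
    [altfun M i.+1] on both sides of it vanishes. *)
Lemma dimension_shift j : (forall i, (i < j)%N -> acyclic (altfun M i.+1)) ->
  forall k n (e : n.+1 = (k.+1 + j)%N),
  exists u : {additive Hgrp k.+1 G (Altz M j.+1) -> Hgrp n.+1 G M},
    bijective u /\ forall z, u (curry_class e z) = beta n.+1 G M (cls z).
Proof.
elim: j => [|j IH] acy k n e.
  have ek : k = n by move: e; rewrite addn0 => -[].
  subst k; have [u [uK Ku]] := additive_inv (Hmap_bij n.+1 augmentation_bij).
  exists u; split; first by exists (Hmap augmentation n.+1).
  by move=> z; rewrite curry_class_base uK.
have e' : n.+1 = (k.+2 + j)%N by lia.
have [|u [ub uE]] := IH _ k.+1 n e'; first by move=> i ij; apply: acy; lia.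
have [d [qd di dE]] := curry_class_conn M j k.+1.
have A0 := acy j (ltnSn j).
exists (u \o d); split; last by move=> z; rewrite /= (dE _ _ e') uE.
apply: bij_comp ub _; apply: inj_surj_bij.
  apply: additive_inj => x /qd[y <-].
  by rewrite (A0 _ y) raddf0.
by move=> y; apply/di; apply: A0.
Qed.

(** Exterior cocycles are the invariants of a syzygy, and the coboundaries are
    the images of invariant alternating functions. The long exact sequence in
    degrees 0 and 1 turns this cokernel into a kernel. *)
Lemma ext_cohomology m : exists alpha : {additive Hlam m.+1 G M -> Hgrp 1 G (Altz M m.+1)},
  [/\ injective alpha, exact_at alpha (Hmap (Altz_incl M m.+1) 1) &
      forall (e : m.+1 = (1 + m)%N) z, alpha (cls z) = curry_class e z].
Proof.
have [d [qd di dE]] := curry_class_conn M m 0.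
have e1 : m.+1 = (1 + m)%N by [].
have e0 : m.+1 = (0 + m.+1)%N by [].
have c0E (z : cocycle (ext_complex M) m.+1) h g :
    gker_val (cochain_map (Altq M m.+1) (curry e0 (val z)) h) g = val z g.
  rewrite [LHS]/=; have := ext_cof z (tcons (h ord0) g); rewrite cof_cons => /eqP.
  rewrite subr_eq0 => /eqP ->; congr cof; apply/funext => u.
  have ch : codom h = [:: h ord0].
    rewrite {1}(tcons_eta h) codom_tcons; congr (_ :: _).
    by apply: size0nil; rewrite size_codom_ord.
  by rewrite /curry_fun ch tup_cons codomK.
have R0 (z : cocycle (ext_complex M) m.+1) : is_coboundary (val z) <-> curry_class e1 z = 0.
  rewrite -(dE _ e0 e1); split=> [[y yz]|/qd[x]].
    apply/qd; exists (cls (const_cocycle (ext_altfun_invariant y))).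
    rewrite [LHS]cohomology_map_cls; congr cls; apply: val_inj.
    apply: cochain_ext => h; apply: altz_ext => g; rewrite c0E -yz.
    by [].
  have [w <-] := cls_surj x; rewrite [LHS]cohomology_map_cls => /cls0_inj e.
  pose a := val w (fun _ => 1%g).
  have aG s : gact s a = a by apply: cocycle0_invariant.
  exists (altfun_ext_cochain aG); apply: ext_cochain_ext => g.
  rewrite -(c0E z (fun _ => 1%g) g).
  by have := congr1 (fun w' : cocycle (group_complex (Altz M m.+2)) 0 =>
    (gker_val (val w' (fun _ => 1%g)) : altfun M m.+2) g) e.
pose R a b := exists z : cocycle (ext_complex M) m.+1, cls z = a /\ curry_class e1 z = b.
have [] := @additive_of_rel _ _ R.
- by move=> a; have [z <-] := cls_surj a; exists (curry_class e1 z), z.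
- move=> a a' b b' [z [<- <-]] [z' [<- <-]]; exists (z - z').
  by rewrite clsB curry_classB.
- by move=> b [z [/cls_eq0 z0 <-]]; apply/R0.
move=> f fP; have fE z : f (cls z) = curry_class e1 z by apply: fP; exists z.
exists f; split; last first.
- by move=> e z; rewrite fE; congr curry_class; apply: eq_irrelevance.
- move=> b; split=> [/di[x <-]|[x <-]]; last first.
    have [z <-] := cls_surj x; rewrite fE -(dE _ e0 e1); apply/di; by eexists.
  have [w <-] := cls_surj x.
  pose a := gker_val (val w (fun _ => 1%g)).
  have aG s : gact s a = a.
    exact: (congr1 (@gker_val _ _ _ _) (cocycle0_invariant w (fun _ => 1%g) s)).
  have da : cc_diff (ext_complex M) m.+1 (altfun_ext_cochain aG) = 0.
    apply: ext_cochain_ext => g.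
    have := congr1 (fun b : altfun M _ => b g) (gker_eq0 (val w (fun _ => 1%g))).
    by [].
  exists (cls (mkcocycle da)); rewrite fE -(dE _ e0 e1); congr (d _).
  congr cls; apply: val_inj; apply: cochain_ext => h; apply: altz_ext => g.
  rewrite c0E; congr (altfun_val (gker_val _) g); exact: cocycle0_const.
- apply: additive_inj => x; have [z <-] := cls_surj x.
  by rewrite fE => /R0 z0; apply/cls_eq0.
Qed.

End Shift.

(** The last acyclic module makes the whole of the first cohomology of the
    syzygy exterior. *)
Lemma beta_bij (G : groupType) (M : gmodType G) m :
  (forall i, (i <= m)%N -> acyclic (altfun M i.+1)) -> bijective (beta m.+1 G M).
Proof.
move=> acy; have e : m.+1 = (1 + m)%N by [].
have [|u [ub uE]] := @dimension_shift G M m _ 0 m e; first by move=> i im; apply/acy/ltnW.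
have [al [alI ale alE]] := ext_cohomology M m.
suff -> : beta m.+1 G M = u \o al :> (_ -> _).
  apply: bij_comp ub (inj_surj_bij alI _) => y; apply/ale; exact: acy.
by apply/funext => x; have [z <-] := cls_surj x; rewrite -uE -(alE e).
Qed.

Lemma beta0_bij (G : groupType) (M : gmodType G) : bijective (beta 0 G M).
Proof.
apply: inj_surj_bij.
  apply: additive_inj => x; have [z <-] := cls_surj x.
  rewrite [beta 0 G M _]cohomology_map_cls => /cls_eq0 /= z0.
  by apply/cls_eq0/val_inj.
move=> y; have [z <-] := cls_surj y.
have A : val z \in @alternating G M 0 by apply/asboolP; case.
have dA : cc_diff (ext_complex M) 0 (ExtCochain A) = 0.
  by apply: val_inj; exact: (cocycle_diff z).
exists (cls (mkcocycle dA)); rewrite [LHS]cohomology_map_cls; congr cls.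
exact: val_inj.
Qed.

Lemma coprime_torsion (A : zmodType) (x : A) m n :
  coprime m n -> x *+ m = 0 -> x *+ n = 0 -> x = 0.
Proof.
move=> co xm xn; have [m0|m0] := posnP m.
  by move: co; rewrite m0 /coprime gcd0n => /eqP n1; rewrite n1 in xn.
have [a b e _] := egcdnP n m0; move: co; rewrite /coprime => /eqP g1.
have : x *+ (a * m) = x *+ (b * n + 1) by rewrite e g1.
by rewrite mulrnDr (mulnC a) (mulnC b) !mulrnA xm xn !mul0rn add0r.
Qed.

(** * Cohomology of groups of prime order *)

Lemma has_order_uniq (G : groupType) (s : G) m n : has_order s m -> has_order s n -> m = n.
Proof.
move=> [m0 sm nm] [n0 sn nn]; case: (ltngtP m n) => // h.
  by case: (nn m); rewrite ?m0.
by case: (nm n); rewrite ?n0.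
Qed.

Section PrimeOrder.
Variables (p : nat) (G : groupType) (M : gmodType G).
Variables (e : 'I_p.+1 -> G) (r : G -> 'I_p.+1).
Hypotheses (eK : cancel e r) (rK : cancel r e).

Lemma alt_acyclic_prime_order i : prime p.+1 -> (i < p)%N -> acyclic (altfun M i.+1).
Proof.
move=> pP ip; apply: alt_acyclic => g gI s sg.
have [m [mi sm _]] := stabilizes_order gI sg.
have [|m' [m'p sm' _]] := @stabilizes_order G p e s (can_inj eK).
  by move=> k; exists (r (s * e k)%g); rewrite rK.
have mm := has_order_uniq sm sm'; subst m'.
have /primeP[_ /(_ m m'p)] := pP; case/orP=> /eqP em.
  by case: sm => _; rewrite em.
by move: (dvdn_leq (ltn0Sn i) mi); rewrite em; lia.
Qed.

Lemma alt_top_eq0 (a : altfun M p.+2) : a = 0.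
Proof.
apply: altfun_ext => g; rewrite altfun0.
apply: (alternates_eq0 (altfun_alternates a)) => gI.
have /leq_card : injective (r \o g) by apply: inj_comp gI; exact: can_inj rK.
by rewrite !card_ord ltnn.
Qed.

(** The alternating complex of [M] ends with [altfun M p.+1], which thus is the
    last syzygy, and the [p] modules [altfun M 1], ..., [altfun M p] before it
    are acyclic. *)
Lemma prime_order_shift k n : prime p.+1 -> n.+1 = (k.+1 + p)%N ->
  iso (Hgrp k.+1 G (altfun M p.+1)) (Hgrp n.+1 G M).
Proof.
move=> pP en; apply: iso_trans (Hgrp k.+1 G (Altz M p.+1)) _ _ _.
  apply: iso_sym; exists (Hmap (Altz_incl M p.+1) k.+1); apply: Hmap_bij.
  apply: inj_surj_bij; first exact: gker_incl_inj.
  by move=> a; exists (mkgker (alt_top_eq0 (Altd M p.+1 a))).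
have [|u [ub _]] := @dimension_shift G M p _ k n en; last by exists u.
by move=> i ip; apply: alt_acyclic_prime_order.
Qed.

End PrimeOrder.

Lemma alt_Hprod (G : groupType) (M : gmodType G) p k n :
  prime p.+1 -> n.+1 = (k.+1 + p)%N ->
  iso (Hgrp k.+1 G (altfun M p.+1)) (Hprod p.+1 n.+1 G M).
Proof.
move=> pP en; apply: iso_trans (alt_prime_subgroups M pP k) _.
apply: iso_dprod => C; have [e [r [eK rK]]] := subgroup_enum C.
exact: prime_order_shift eK rK _ _ pP en.
Qed.

(** * Exact sequences *)

(** An exact sequence from [X1] to [X3] becomes one of the groups to be compared:
    [L] and [L'] map onto the kernels of [i] and [i'], while [X1] and [X3] embed
    in [H] and [H']. Vanishing of [i' \o q] lets the map out of [Y] land in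
    [L']. *)
Lemma splice (L H L' H' X1 Y X2 X3 Y' P : zmodType)
    (b : {additive L -> H}) (b' : {additive L' -> H'})
    (al : {additive L -> X1}) (u : {additive X1 -> H})
    (i : {additive X1 -> Y}) (q : {additive Y -> X2}) (d : {additive X2 -> X3})
    (al' : {additive L' -> X2}) (i' : {additive X2 -> Y'})
    (w : {additive X3 -> H'}) :
  bijective u -> (forall x, u (al x) = b x) -> exact_at al i ->
  exact_at i q -> exact_at q d ->
  injective al' -> exact_at al' i' -> (forall y, i' (q y) = 0) ->
  injective w -> (forall x, w (d (al' x)) = b' x) ->
  iso Y P ->
  exists (r : {additive H -> P}) (t : {additive P -> L'}),
    [/\ exact_at b r, exact_at r t & exact_at t b'].
Proof.
move=> ub ube ale iqe qde al'I al'e i'q wI wE [v vb].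
have [u' [uK u'K]] := additive_inv ub; have [v' [vK v'K]] := additive_inv vb.
pose R y x := al' x = q (v' y).
have [] := @additive_of_rel _ _ R.
- by move=> y; apply/al'e; apply: i'q.
- by move=> y y' x x'; rewrite /R !raddfB => -> ->.
- by move=> x; rewrite /R !raddf0 => x0; apply: al'I; rewrite x0 raddf0.
move=> t tP; have tE y : al' (t y) = q (v' y).
  by have [x xP] : exists x, al' x = q (v' y) by [apply/al'e; apply: i'q]; rewrite (tP y x).
exists (v \o i \o u'), t; split=> y /=.
- split=> [vy|[x <-]].
    have /ale[x xy] : i (u' y) = 0 by apply: (bij_inj vb); rewrite vy raddf0.
    by exists x; rewrite -ube xy u'K.
  by rewrite -ube uK (_ : i _ = 0) ?raddf0 //; apply/ale; exists x.
- split=> [ty|[x <-]].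
    have /iqe[x xy] : q (v' y) = 0 by rewrite -tE ty raddf0.
    by exists (u x); rewrite /= uK xy v'K.
  by apply: al'I; rewrite tE vK raddf0; apply/iqe; eexists.
- rewrite -wE; split=> [|[x <-]].
    rewrite -(raddf0 w) => /wI /qde[x xy]; exists (v x).
    by apply: al'I; rewrite tE vK.
  by rewrite tE (_ : d _ = 0) ?raddf0 //; apply/qde; eexists.
Qed.

Section Sequences.
Variables (G : groupType) (M : gmodType G) (m : nat).
Hypothesis acy : forall i, (i < m)%N -> acyclic (altfun M i.+1).

Lemma beta_inj : injective (beta m.+1 G M).
Proof.
have e : m.+1 = (1 + m)%N by [].
have [u [ub uE]] := dimension_shift acy e.
have [al [alI _ alE]] := ext_cohomology M m.
suff -> : beta m.+1 G M = u \o al :> (_ -> _) by apply: inj_comp alI; apply: bij_inj.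
by apply/funext => x; have [z <-] := cls_surj x; rewrite -uE -(alE e).
Qed.

(** The source is killed by [j] and the target by [j']. *)
Lemma torsion_map j j' k k'
    (f : {additive Hgrp k.+1 G (altfun M j) -> Hgrp k'.+1 G (altfun M j')}) :
  coprime j j' -> forall x, f x = 0.
Proof.
move=> co x; apply: coprime_torsion co _ _; last exact: altcoh_torsion.
by rewrite -raddfMn altcoh_torsion raddf0.
Qed.

(** The obstruction lies between groups killed by the consecutive integers
    [m.+1] and [m.+2], hence vanishes. *)
Lemma sequence_low (P : zmodType) : iso (Hgrp 1 G (altfun M m.+1)) P ->
  exists (r : {additive Hgrp m.+1 G M -> P}) (t : {additive P -> Hlam m.+2 G M}),
    [/\ exact_at (beta m.+1 G M) r, exact_at r t & exact_at t (beta m.+2 G M)].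
Proof.
have e : m.+1 = (1 + m)%N by [].
have e1 : m.+2 = (1 + m.+1)%N by [].
have e2 : m.+2 = (2 + m)%N by [].
have [u [ub uE]] := dimension_shift acy e.
have [w [wb wE]] := dimension_shift acy e2.
have [al [_ ale alE]] := ext_cohomology M m.
have [al' [al'I al'e al'E]] := ext_cohomology M m.+1.
have [d [qd di dE]] := curry_class_conn M m 1.
apply: (@splice _ _ _ _ _ _ _ _ _ _ (beta m.+1 G M) (beta m.+2 G M) al u
  (Hmap (Altz_incl M m.+1) 1) (Hmap (Altq M m.+1) 1) d al' (Hmap (Altz_incl M m.+2) 1) w) => //.
- by move=> x; have [z <-] := cls_surj x; rewrite -uE -(alE e).
- exact: Alt_les_middle.
- exact: (torsion_map (Hmap (Altz_incl M m.+2) 1 \o Hmap (Altq M m.+1) 1) (coprimenS m.+1)).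
- exact: bij_inj.
- by move=> x; have [z <-] := cls_surj x; rewrite (al'E e1) (dE _ e1 e2) wE.
Qed.

(** One degree higher, both exterior groups are reached after one more connecting
    map, and acyclicity of [altfun M m.+2] makes the one for [Hlam m.+3]
    bijective. *)
Lemma sequence_high (P : zmodType) : acyclic (altfun M m.+2) -> coprime m.+1 m.+3 ->
  iso (Hgrp 2 G (altfun M m.+1)) P ->
  exists (r : {additive Hgrp m.+2 G M -> P}) (t : {additive P -> Hlam m.+3 G M}),
    [/\ exact_at (beta m.+2 G M) r, exact_at r t & exact_at t (beta m.+3 G M)].
Proof.
move=> acy2 co.
have e1 : m.+2 = (1 + m.+1)%N by [].
have e2 : m.+2 = (2 + m)%N by [].
have f1 : m.+3 = (1 + m.+2)%N by [].
have f2 : m.+3 = (2 + m.+1)%N by [].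
have f3 : m.+3 = (3 + m)%N by [].
have [u [ub uE]] := dimension_shift acy e2.
have [w [wb wE]] := dimension_shift acy f3.
have [al [_ ale alE]] := ext_cohomology M m.+1.
have [al' [al'I al'e al'E]] := ext_cohomology M m.+2.
have [c [_ ci cE]] := curry_class_conn M m 1.
have [d [qd _ dE]] := curry_class_conn M m 2.
have [c' [qc' c'i c'E]] := curry_class_conn M m.+1 1.
have c'b : bijective c'.
  apply: inj_surj_bij; first by apply: additive_inj => x /qc'[y <-]; rewrite (acy2 _ y) raddf0.
  by move=> y; apply/c'i; apply: acy2.
have [c1 [c'K c1K]] := additive_inv c'b.
apply: (@splice _ _ _ _ _ _ _ _ _ _ (beta m.+2 G M) (beta m.+3 G M) (c \o al) u
  (Hmap (Altz_incl M m.+1) 2) (Hmap (Altq M m.+1) 2) d (c' \o al')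
  (Hmap (Altz_incl M m.+3) 1 \o c1) w) => //.
- by move=> x; have [z <-] := cls_surj x; rewrite /= (alE e1) (cE _ e1 e2) uE.
- move=> y; split=> [/ci[x <-]|[x <-]]; last by apply/ci; eexists.
  have [|x' <-] := (ale x).1; first exact: acy2.
  by exists x'.
- exact: Alt_les_middle.
- exact: inj_comp (bij_inj c'b) al'I.
- move=> y; split=> [/al'e[x xy]|[x <-]]; first by exists x; rewrite /= xy c1K.
  by rewrite /= c'K; apply/al'e; exists x.
- exact: (torsion_map ((Hmap (Altz_incl M m.+3) 1 \o c1) \o Hmap (Altq M m.+1) 2) co).
- exact: bij_inj.
- by move=> x; have [z <-] := cls_surj x; rewrite /= (al'E f1) (c'E _ f1 f2) (dE _ f2 f3) wE.
Qed.

End Sequences.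

Theorem corollary4p4 (G : groupType) (M : gmodType G) :
  [/\ (* (i) *)
      [/\ bijective (beta 0 G M),
          bijective (beta 1 G M) &
          exists (r2 : {additive Hgrp 2 G M -> Hprod 2 2 G M})
                 (t2 : {additive Hprod 2 2 G M -> Hlam 3 G M}),
          [/\ injective (beta 2 G M),
              exact_at (beta 2 G M) r2,
              exact_at r2 t2 &
              exact_at t2 (beta 3 G M)]],
      (* (ii) *)
      (forall g : G, ~ has_order g 2) ->
      bijective (beta 2 G M) /\
      exists (r3 : {additive Hgrp 3 G M -> Hprod 3 3 G M})
             (t3 : {additive Hprod 3 3 G M -> Hlam 4 G M})
             (r4 : {additive Hgrp 4 G M -> Hprod 3 4 G M})
             (t4 : {additive Hprod 3 4 G M -> Hlam 5 G M}),
      [/\ [/\ injective (beta 3 G M),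
              exact_at (beta 3 G M) r3,
              exact_at r3 t3 &
              exact_at t3 (beta 4 G M)],
          exact_at (beta 4 G M) r4,
          exact_at r4 t4 &
          exact_at t4 (beta 5 G M)] &
      (* (iii) *)
      (forall g : G, g <> 1%g -> infinite_order g) ->
      forall i : nat, bijective (beta i G M)].
Proof.
have A1 i : (i < 1)%N -> acyclic (altfun M i.+1).
  by case: i => // _; apply: alt1_acyclic.
split.
- split; [exact: beta0_bij|exact: beta_bij|].
  have [r [t [e1 e2 e3]]] := sequence_low A1 (@alt_Hprod G M 1 0 1 isT erefl).
  by exists r, t; split=> //; apply: beta_inj.
- move=> no2.
  have A2 i : (i < 2)%N -> acyclic (altfun M i.+1).
    by case: i => [|[|i]] // _; [apply: alt1_acyclic|apply: alt_acyclic_no_involution].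
  split; first exact: beta_bij.
  have [r [t [e1 e2 e3]]] := sequence_low A2 (@alt_Hprod G M 2 0 2 isT erefl).
  have A4 : acyclic (altfun M 4) by apply: alt_acyclic_no_involution.
  have [r' [t' [f1 f2 f3]]] := sequence_high A2 A4 isT (@alt_Hprod G M 2 1 3 isT erefl).
  by exists r, t, r', t'; split=> //; split=> //; apply: beta_inj.
- move=> tf [|i]; first exact: beta0_bij.
  by apply: beta_bij => j _; apply: alt_acyclic_torsionfree.
Qed.
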